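(* Let $G$ be a connected graph of maximum degree $\Delta=\Delta(G)\geq 3$, and let $\mathcal L$ consist of list assignments $L$ on $G$ satisfying $|L(v)|\geq \deg(v)+1$ whenever $\deg(v)<\Delta(G)$ and $|L(v)|\geq \deg(v)$ whenever $\deg(v)=\Delta(G)$. If $G\not\cong K_{\Delta+1}$, then $G$ is $\frac{1}{6\Delta}$-flexibly $\mathcal L$-choosable.
   Context: Graphs are finite and simple. A list assignment $L$ on $G$ assigns to each vertex $v$ a set $L(v)$ of colors. An $L$-coloring is a proper coloring $\varphi$ of $G$ with $\varphi(v)\in L(v)$ for every $v\in V(G)$. A request on $G$ with list assignment $L$ is a function $r$ with $\operatorname{dom}(r)\subseteq V(G)$ and $r(v)\in L(v)$ for all $v\in\operatorname{dom}(r)$. For $\varepsilon>0$, $r$ is $\varepsilon$-satisfiable if there is an $L$-coloring $\varphi$ of $G$ such that $\varphi(v)=r(v)$ for at least $\varepsilon|\operatorname{dom}(r)|$ vertices $v\in\operatorname{dom}(r)$. $G$ is $\varepsilon$-flexibly $\mathcal L$-choosable if, for every $L\in\mathcal L$, every request on $G$ with list assignment $L$ is $\varepsilon$-satisfiable. *)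

(* Defs.v *)
From HB Require Import structures.
From mathcomp Require Import all_boot all_order all_algebra.
From mathcomp Require Import boolp classical_sets functions cardinality.

Set Implicit Arguments.
Unset Strict Implicit.
Unset Printing Implicit Defensive.

Import Order.TTheory GRing.Theory Num.Theory.
Local Open Scope ring_scope.

Record sgraph := SGraph {
  vertex :> finType;
  adj : rel vertex;
  adj_sym : symmetric adj;
  adj_irrefl : irreflexive adj }.

Definition deg (G : sgraph) (v : G) : nat := #|[set u | adj v u]%SET|.

Definition max_degree (G : sgraph) : nat := (\max_(v : G) deg v)%N.

Definition connected_graph (G : sgraph) : Prop :=
  (0 < #|G|)%N /\ forall x y : G, connect (@adj G) x y.

Definition graph_iso (G H : sgraph) : Prop :=
  exists2 f : G -> H, bijective f & forall x y : G, adj (f x) (f y) = adj x y.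

Definition complete_adj (n : nat) : rel 'I_n := [rel x y | x != y].

Lemma complete_adj_sym (n : nat) : symmetric (@complete_adj n).
Proof. by move=> x y; rewrite /complete_adj /= eq_sym. Qed.

Lemma complete_adj_irrefl (n : nat) : irreflexive (@complete_adj n).
Proof. by move=> x; rewrite /complete_adj /= eqxx. Qed.

Definition complete_graph (n : nat) : sgraph :=
  SGraph (@complete_adj_sym n) (@complete_adj_irrefl n).

                                                             
Definition list_assignment (G : sgraph) (C : eqType) : Type := G -> set C.

                                                                   
Definition card_geq (C : Type) (A : set C) (n : nat) : Prop := (`I_n #<= A)%card.

Definition list_coloring (G : sgraph) (C : eqType) (L : list_assignment G C)
    (phi : G -> C) : Prop :=
  (forall x y : G, adj x y -> phi x <> phi y) /\ (forall v : G, L v (phi v)).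

                                                                              
                                                                          
Definition dom (G : sgraph) (C : eqType) (r : G -> option C) : {set G} :=
  [set v | r v != None]%SET.

Definition request (G : sgraph) (C : eqType) (L : list_assignment G C)
    (r : G -> option C) : Prop :=
  forall (v : G) (c : C), r v = Some c -> L v c.

Definition satisfiable (R : realFieldType) (eps : R) (G : sgraph) (C : eqType)
    (L : list_assignment G C) (r : G -> option C) : Prop :=
  exists2 phi : G -> C, list_coloring L phi &
    eps * #|dom r|%:R <= #|[set v in dom r | r v == Some (phi v)]%SET|%:R.

Definition flexibly_choosable (R : realFieldType) (eps : R) (G : sgraph)
    (C : eqType) (LL : set (list_assignment G C)) : Prop :=
  forall L : list_assignment G C, LL L ->
  forall r : G -> option C, request L r -> satisfiable eps L r.

Definition degree_lists (G : sgraph) (C : eqType) : set (list_assignment G C) :=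
  [set L | forall v : G,
     ((deg v < max_degree G)%N -> card_geq (L v) (deg v).+1) /\
     (deg v = max_degree G -> card_geq (L v) (deg v))]%classic.

(* Main.v *)
(* Fix an L-colouring satisfying as many requests as possible, let S be the set of vertices whose
   request it satisfies and D the maximum degree.  Let t be an unsatisfied request without
   neighbours in S.  If t is coloured as requested and S is kept, some component H of G - S - t
   admits no colouring.  Greedy colouring shows that H is tight: every list has exactly as many
   colours left as the vertex has neighbours in H, so all its vertices have degree D.  As in the
   theorem of Gallai and Erdos-Rubin-Taylor, it follows that every vertex of H with no neighbour
   in S + t is a cut vertex of H, and that every side of a cut vertex sends at least D - 1 edges
   to S + t.

   Let K be a component of G - S with e edges to S.  If some side of K - t contains only vertices
   that have a neighbour in S or are cut vertices of K, then t branches in K; pruning innermost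
   sides one by one bounds the number of these t by 2e - 2.  For the other t, either the sets H
   are pairwise disjoint, whence there are at most e of them, or H = K - t for all of them.  In
   the latter case two of them may separate two others in K, and then K has at most 4e vertices
   without neighbours in S; otherwise there are at most D + 1 of them while e >= D - 2, or all the
   K - t are regular and there are at most e + 1.  So K contains at most 4e such t and 5e requests,
   and a sum over K bounds the number of requests by |S| + 5 D |S| <= 6 D |S|. *)

Require Import Defs.
From mathcomp Require Import all_boot zify.

Set Implicit Arguments.
Unset Strict Implicit.
Unset Printing Implicit Defensive.

(** * Connectivity through closed subsets *)

Section Connectivity.
Variable G : sgraph.
Implicit Types (A B D H K P U Z : {set G}) (a u v w y z : G) (x : G -> nat).

Definition nbr v : {set G} := [set u | adj v u].

Definition dgin H v : nat := #|nbr v :&: H|.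

Lemma adj_neq u v : adj u v -> u != v.
Proof. by apply: contraTneq => ->; rewrite adj_irrefl. Qed.

(** Such sets are the unions of components of the subgraph induced on [H]; inside [H :\ z] they are
    unions of sides of [z]. They replace paths throughout. *)
Definition closed_in A H : bool :=
  (A \subset H) && [forall u in A, nbr u :&: H \subset A].

Definition conn H : bool :=
  [forall A : {set G}, closed_in A H ==> (A != set0) ==> (A == H)].

Lemma closedP A H :
  reflect (A \subset H /\ forall u v, u \in A -> v \in H -> adj u v -> v \in A)
          (closed_in A H).
Proof.
apply: (iffP andP) => -[sAH cA]; split=> //.
  move=> u v uA vH uv; have /subsetP := forall_inP cA u uA.
  by apply; rewrite !inE uv.
apply/forall_inP=> u uA; apply/subsetP=> v; rewrite !inE => /andP[uv vH].
exact: (cA u).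
Qed.

Lemma connP H :
  reflect (forall A, closed_in A H -> A != set0 -> A = H) (conn H).
Proof.
apply: (iffP forallP) => cH A; first by move=> cA nA; apply/eqP/(implyP (implyP (cH A) cA)).
by apply/implyP=> cA; apply/implyP=> nA; apply/eqP/cH.
Qed.

Lemma closedD A H : closed_in A H -> closed_in (H :\: A) H.
Proof.
move=> /closedP[sAH cA]; apply/closedP; split; first exact: subsetDl.
move=> u v; rewrite !inE => /andP[uA uH] vH uv; rewrite vH andbT.
by apply: contra uA => vA; apply: (cA v) => //; rewrite adj_sym.
Qed.

Lemma closedSD A D H : closed_in A H -> closed_in (A :\: D) (H :\: D).
Proof.
move=> /closedP[sAH cA]; apply/closedP; split; first exact: setSD.
move=> u v; rewrite !inE => /andP[uD uA] /andP[-> vH] uv /=; exact: (cA u).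
Qed.

Lemma closed_sub A H U : closed_in A H -> A \subset U -> U \subset H -> closed_in A U.
Proof.
move=> /closedP[sAH cA] sAU /subsetP sUH; apply/closedP; split=> // u v uA vU.
by apply: cA => //; apply: sUH.
Qed.

Lemma closed_trans A B H : closed_in A B -> closed_in B H -> closed_in A H.
Proof.
move=> /closedP[sAB cA] /closedP[sBH cB]; apply/closedP; split.
  exact: subset_trans sBH.
move=> u v uA vH uv; apply: (cA u) => //; apply: (cB u) => //.
exact: (subsetP sAB).
Qed.

Lemma closedI A H U : closed_in A H -> U \subset H -> closed_in (A :&: U) U.
Proof.
move=> /closedP[sAH cA] /subsetP sUH; apply/closedP; split; first exact: subsetIr.
move=> u v; rewrite !inE => /andP[uA uU] vU uv; rewrite vU andbT.
by apply: (cA u) => //; apply: sUH.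
Qed.

Lemma conn_sub A B H u :
  closed_in A H -> conn B -> B \subset H -> u \in A -> u \in B -> B \subset A.
Proof.
move=> cA /connP cB sBH uA uB; rewrite -(cB (A :&: B)) ?subsetIl ?closedI //.
  exact: (closedI cA).
by apply/set0Pn; exists u; rewrite inE uA.
Qed.

Lemma conn_nbr H z A : conn H -> z \in H -> closed_in A (H :\ z) -> A != set0 ->
  exists2 v, v \in A & adj z v.
Proof.
move=> /connP cH zH /closedP[sA cA] nA.
have [/exists_inP[v vA zv]|nx] := boolP [exists v in A, adj z v]; first by exists v.
have zA : z \notin A by apply/negP => /(subsetP sA); rewrite !inE eqxx.
suff AH : A = H by rewrite AH zH in zA.
apply: cH => //; apply/closedP; split; first exact: subset_trans sA (subsetDl _ _).
move=> u v uA vH uv; apply: (cA u) => //; rewrite !inE vH andbT.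
apply: contraNneq nx => vz; apply/exists_inP; exists u => //.
by rewrite -vz adj_sym.
Qed.

(** A closed subset of the rest that contains [z] becomes closed in [H] once [A] is added; one that
    misses [z] is excluded through its complement. *)
Lemma conn_del H z A : conn H -> z \in H -> closed_in A (H :\ z) -> conn (H :\: A).
Proof.
move=> cH zH cA; have /closedP[sA cA'] := cA.
have zA : z \notin A by apply/negP => /(subsetP sA); rewrite !inE eqxx.
have main B : closed_in B (H :\: A) -> z \in B -> B = H :\: A.
  move=> /closedP[sB cB] zB; suff /setP BH : B :|: A = H.
    apply/setP=> u; have := BH u; rewrite !inE; case: (boolP (u \in A)) => uA.
      rewrite /= => _; apply/negP => /(subsetP sB); by rewrite !inE uA.
    by rewrite orbF.
  move/connP: cH; apply; last by apply/set0Pn; exists z; rewrite inE zB.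
  apply/closedP; split.
    by rewrite subUset (subset_trans sB (subsetDl _ _)) (subset_trans sA (subsetDl _ _)).
  move=> u v; rewrite !inE => uBA vH uv; case: (boolP (v \in A)) => vA; rewrite ?orbT ?orbF //.
  case/orP: uBA => [uB|uA]; first by apply: (cB u) => //; rewrite !inE vA.
  have [->//|vz] := eqVneq v z; case/negP: vA; apply: (cA' u) => //; by rewrite !inE vz.
apply/connP => B cB nB; have [/(main _ cB)//|zB] := boolP (z \in B).
have := main _ (closedD cB); rewrite !inE zB zH zA /= => /(_ isT) e.
have /closedP[sB _] := cB; case/set0Pn: nB => u uB.
have := subsetP sB u uB; rewrite -e !inE uB.
by [].
Qed.

Lemma conn_addS H z A : conn H -> z \in H -> closed_in A (H :\ z) -> conn (z |: A).
Proof.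
move=> cH zH cA; have /closedP[sA _] := cA.
suff -> : z |: A = H :\: ((H :\ z) :\: A) by apply: conn_del cH zH (closedD cA).
apply/setP=> u; rewrite !inE; have := subsetP sA u; rewrite !inE.
have [->|_] := eqVneq u z; rewrite ?zH ?andbF //=.
by case: (u \in A) => [/(_ isT) ->|_] //=; case: (u \in H).
Qed.

Lemma conn_U A B u : conn A -> conn B -> u \in A -> u \in B -> conn (A :|: B).
Proof.
move=> cA cB uA uB; apply/connP=> D cD /set0Pn[v vD].
have /closedP[sD _] := cD.
have uD : u \in D.
  have := subsetP sD v vD; rewrite inE => /orP[vA|vB].
    exact: (subsetP (conn_sub cD cA (subsetUl _ _) vD vA)).
  exact: (subsetP (conn_sub cD cB (subsetUr _ _) vD vB)).
apply/eqP; rewrite eqEsubset sD subUset (conn_sub cD cA (subsetUl _ _) uD uA).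
exact: (conn_sub cD cB (subsetUr _ _) uD uB).
Qed.

Lemma cut_side H b : ~~ conn H ->
  exists A, [/\ closed_in A H, A != set0, H :\: A != set0 & b \notin A].
Proof.
rewrite negb_forall => /existsP[A]; rewrite !negb_imply => /and3P[cA nA AH].
have /closedP[sA _] := cA.
have nC : H :\: A != set0 by rewrite setD_eq0; move: AH; rewrite eqEsubset sA.
have [bA|bA] := boolP (b \in A); last by exists A.
exists (H :\: A); split=> //; [exact: closedD| |by rewrite inE bA].
by rewrite setDDr setDv set0U (setIidPr sA).
Qed.

Lemma not_conn A H : closed_in A H -> A != set0 -> H :\: A != set0 -> ~~ conn H.
Proof.
move=> cA nA nC; apply/negP => /connP cH; move: nC.
by rewrite (cH _ cA nA) setDv eqxx.
Qed.

(** A minimal closed set with [Pr] cannot split, as one part would inherit [Pr]. Used for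
    nonemptiness and for uncolourability. *)
Lemma min_conn (Pr : pred {set G}) A H :
    (forall B D, Pr B -> closed_in D B -> Pr D \/ Pr (B :\: D)) -> ~~ Pr set0 ->
    closed_in A H -> Pr A ->
  exists B, [/\ B \subset A, closed_in B H, conn B & Pr B].
Proof.
move=> split P0 cA PA; have := @minset_exists _ (fun B => closed_in B H && Pr B) A.
rewrite cA PA => /(_ isT)[B /minsetP[/andP[cB PB] minB] sBA]; exists B; split=> //.
apply/connP=> D cD nD; have /closedP[sD _] := cD.
have [PD|PD] := split _ _ PB cD.
  by apply: minB sD; rewrite PD (closed_trans cD cB).
have := minB _ _ (subsetDl B D); rewrite PD (closed_trans (closedD cD) cB) => /(_ isT) e.
case/set0Pn: nD => u uD; have := subsetP sD u uD; rewrite -e inE uD.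
by [].
Qed.

Lemma closed_conn A H : closed_in A H -> A != set0 ->
  exists B, [/\ B \subset A, closed_in B H, conn B & B != set0].
Proof.
move=> cA nA; apply: (@min_conn (fun B => B != set0)) => //; last by rewrite eqxx.
move=> B D nB /closedP[sD _]; have [D0|] := eqVneq D set0; last by left.
by right; rewrite D0 setD0.
Qed.

End Connectivity.

(** * Sides of a vertex *)

Section Counting.
Variable G : sgraph.
Implicit Types (A B D H K P U Z : {set G}) (a u v w y z : G) (x : G -> nat).

Lemma closed_nadj A H u v :
  closed_in A H -> u \in A -> v \in H -> v \notin A -> ~~ adj u v.
Proof.
by move=> /closedP[_ cA] uA vH; apply: contra => uv; apply: cA uv.
Qed.

Lemma dginS A H v : A \subset H -> dgin A v <= dgin H v.
Proof. by move=> sAH; apply/subset_leq_card/setIS. Qed.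

Lemma dgin_split A H v : A \subset H -> dgin H v = dgin A v + dgin (H :\: A) v.
Proof.
move=> sAH; rewrite /dgin -(cardsID A (nbr v :&: H)); congr (_ + _).
  by rewrite -setIA (setIidPr sAH).
by rewrite setIDA.
Qed.

Lemma dgin_eq A H v : A \subset H ->
  (forall u, u \in H -> adj v u -> u \in A) -> dgin A v = dgin H v.
Proof.
move=> /subsetP sAH nA; apply/eq_card => u; rewrite !inE.
by case: (boolP (adj v u)) => //= vu; apply/idP/idP => [/sAH//|/nA]; apply.
Qed.

Lemma dgin_gt0 H v : (0 < dgin H v) = [exists u in H, adj v u].
Proof.
rewrite card_gt0; apply/set0Pn/exists_inP => -[u].
  by rewrite !inE => /andP[vu uH]; exists u.
by move=> uH vu; exists u; rewrite !inE vu.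
Qed.

Lemma dgin_sum A v : dgin A v = \sum_(u in A) adj v u.
Proof.
rewrite /dgin -sum1_card big_mkcond [RHS]big_mkcond; apply: eq_bigr => u _.
by rewrite in_setI inE; case: (adj v u); case: (u \in A).
Qed.

Section RemoveSide.
Variables (K : {set G}) (z : G) (D : {set G}).
Hypotheses (cK : conn K) (zK : z \in K) (cD : closed_in D (K :\ z)) (nD : D != set0).

Lemma side_sub : D \subset K.
Proof. by have /closedP[sD _] := cD; apply: subset_trans sD (subsetDl _ _). Qed.

Lemma side_notin : z \notin D.
Proof.
by apply/negP => /(subsetP (proj1 (closedP _ _ cD))); rewrite !inE eqxx.
Qed.

Lemma side_nadj u w : u \in D -> w \in K -> w != z -> w \notin D -> ~~ adj u w.
Proof. by move=> uD wK wz; apply: closed_nadj cD uD _; rewrite !inE wz. Qed.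

Lemma dgin_remove w : w \in K -> w != z -> w \notin D -> dgin (K :\: D) w = dgin K w.
Proof.
move=> wK wz wD; apply: dgin_eq; first exact: subsetDl.
move=> u uK wu; rewrite inE uK andbT; apply: contraL wu => uD.
by rewrite adj_sym (side_nadj uD).
Qed.

Lemma side_root_sub w E : w \in K -> w != z -> w \notin D -> closed_in E (K :\ w) ->
  forall u, u \in z |: D -> u \in E -> z |: D \subset E.
Proof.
move=> wK wz wD cE u uD uE; apply: (conn_sub cE (conn_addS cK zK cD) _ uE uD).
apply/subsetP => v; rewrite !inE => /orP[/eqP ->|vD]; first by rewrite eq_sym wz.
by rewrite (subsetP side_sub) // andbT; apply: contraNneq wD => <-.
Qed.

(** The connected set [z |: D] avoids [w], so a side of [w] that meets [D] contains [z] and survives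
    the deletion of [D]. *)
Lemma closed_remove w E : w \in K -> w != z -> w \notin D ->
  closed_in E (K :\ w) -> E != set0 -> closed_in (E :\: D) ((K :\: D) :\ w) /\ E :\: D != set0.
Proof.
move=> wK wz wD cE nE; split.
  suff -> : (K :\: D) :\ w = (K :\ w) :\: D by apply: closedSD.
  by rewrite !setDDl setUC.
rewrite setD_eq0; apply/negP => sED; case/set0Pn: nE => u uE.
have uD : u \in z |: D by rewrite !inE (subsetP sED) ?orbT.
have /subsetP/(_ z) := side_root_sub wK wz wD cE uD uE.
by rewrite !inE eqxx => /(_ isT) /(subsetP sED); rewrite (negPf side_notin).
Qed.

Lemma cut_remove w : w \in K -> w != z -> w \notin D ->
  ~~ conn (K :\ w) -> ~~ conn ((K :\: D) :\ w).
Proof.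
move=> wK wz wD /(cut_side w)[E [cE nE nC _]].
have [cE' nE'] := closed_remove wK wz wD cE nE.
have [_ nC'] := closed_remove wK wz wD (closedD cE) nC.
apply: (not_conn cE' nE'); apply: contraNneq nC' => e.
rewrite -subset0 -e; apply/subsetP => u; rewrite !inE.
by case: (u \in D) => //=; rewrite ?andbF.
Qed.

End RemoveSide.

(** [P] holds the exempt vertices. The weight [x] begins as the number of neighbours in [S] and may
    grow while sides are pruned. *)
Definition nice K P x z D : bool :=
  [&& closed_in D (K :\ z), D != set0 &
      [forall v in D :\: P, (3 <= dgin K v + x v) && ((0 < x v) || ~~ conn (K :\ v))]].

(** Among the surviving vertices only [z] loses edges, so only [z] has to be exempted or compensated
    by weight. *)
Lemma nice_remove K z D P P' x x' w E :
    conn K -> z \in K -> closed_in D (K :\ z) -> D != set0 ->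
    w \in K -> w != z -> w \notin D ->
    (forall v, v \in K :\: D -> v \in P -> v \in P') ->
    (forall v, v != z -> x' v = x v) ->
    (z \in P' \/ 0 < x' z /\
       (z \notin P -> 3 <= dgin K z + x z -> 3 <= dgin (K :\: D) z + x' z)) ->
  nice K P x w E -> nice (K :\: D) P' x' w (E :\: D).
Proof.
move=> cK zK cD nD wK wz wD sP ex zP' /and3P[cE nE /forall_inP gE].
have [cE' nE'] := closed_remove cK zK cD wK wz wD cE nE.
apply/and3P; split=> //; apply/forall_inP => v; rewrite !inE => /and3P[vP' vD vE].
have vK : v \in K.
  by have /closedP[/subsetP/(_ v vE)] := cE; rewrite !inE => /andP[].
have vP : v \notin P by apply: contra vP'; apply: sP; rewrite inE vD.
have := gE v; rewrite !inE vP vE => /(_ isT)/andP[d3 xv].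
have [vz|vz] := eqVneq v z.
  subst v; case: zP' => [|[-> d]]; first by rewrite (negPf vP').
  by rewrite orTb andbT d.
rewrite ex // (dgin_remove cD vK vz vD) d3 /=.
by case/orP: xv => [->//|cv]; rewrite (cut_remove cK zK cD vK vz vD cv) orbT.
Qed.

End Counting.

(** * Counting the vertices that have a nice side *)

Section NiceCount.
Variable G : sgraph.
Implicit Types (A B D H K P U Z : {set G}) (a u v w y z : G) (x : G -> nat).

Definition bump x y : G -> nat := fun v => if v == y then (x v).+1 else x v.

Lemma sum_bump x y A : y \in A -> \sum_(v in A) bump x y v = (\sum_(v in A) x v).+1.
Proof.
move=> yA; rewrite (bigD1 y) //= [in RHS](bigD1 y) //= {1}/bump eqxx addSn; congr (_ + _).+1.
by apply: eq_bigr => v /andP[_ vy]; rewrite /bump (negPf vy).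
Qed.

Lemma sum_bump_le x y A : \sum_(v in A) bump x y v <= (\sum_(v in A) x v).+1.
Proof.
have [yA|yA] := boolP (y \in A); first by rewrite sum_bump.
apply: leqW; apply: leq_sum => v vA; rewrite /bump.
by case: eqVneq vA yA => // -> ->.
Qed.

Lemma bump_neq x y v : v != y -> bump x y v = x v.
Proof. by rewrite /bump => /negPf ->. Qed.

Lemma sum_pos_card x A : (forall v, v \in A -> 0 < x v) -> #|A| <= \sum_(v in A) x v.
Proof. by move=> h; rewrite -sum1_card; apply: leq_sum. Qed.

Lemma sum_side x K P D : D \subset K ->
  \sum_(v in K :\: P) x v = \sum_(v in (K :\: D) :\: P) x v + \sum_(v in D :\: P) x v.
Proof.
move=> sDK; rewrite (big_setID D) /= addnC; congr (_ + _); apply: eq_bigl => v.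
  by rewrite !inE; do ![case: (_ \in _) => //=].
rewrite !inE; case: (boolP (v \in D)) => [/(subsetP sDK) ->|]; rewrite ?andbF ?andbT //.
Qed.

Lemma cards_rem1 Z z : #|Z| <= #|Z :\ z| + 1.
Proof. by rewrite (cardsD1 z) addnC leq_add2l leq_b1. Qed.

Lemma cards_rem2 Z z y : #|Z| <= #|Z :\ z :\ y| + (y \in Z) + 1.
Proof.
apply: leq_trans (cards_rem1 Z z) _; rewrite leq_add2r (cardsD1 y) addnC leq_add2l !inE.
by case: (y \in Z); rewrite ?andbF ?leq_b1.
Qed.

Definition slack K P : nat := if P == set0 then 3 else \sum_(a in P) (1 < dgin K a).

Lemma slack1 K a : slack K [set a] = (1 < dgin K a).
Proof.
rewrite /slack big_set1 ifN //; apply/set0Pn; exists a; exact: set11.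
Qed.

(** Minimise [D]: a vertex of weight zero in [D :\: P] would be a cut vertex of degree at least 3
    whose side away from [z] lies in [D], a smaller candidate. *)
Lemma min_nice K P x z0 D0 : conn K ->
    z0 \in K :\: P -> x z0 = 0 -> (P != set0 -> 3 <= dgin K z0) -> nice K P x z0 D0 ->
  exists z D, [/\ z \in K :\: P, x z = 0, P != set0 -> 3 <= dgin K z, nice K P x z D &
                  forall v, v \in D :\: P -> 0 < x v].
Proof.
move=> cK z0K xz0 dz0 nz0.
pose cand (p : G * {set G}) := [&& p.1 \in K :\: P, x p.1 == 0,
  (P != set0) ==> (3 <= dgin K p.1) & nice K P x p.1 p.2].
have c0 : cand (z0, D0) by rewrite /cand /= z0K xz0 eqxx nz0 andbT; apply/implyP.
case: (@arg_minnP _ (z0, D0) cand (fun p => #|p.2|) c0) => -[z D] /and4P[/= zK /eqP xz /implyP dz nz] minD.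
exists z, D; split=> // v vDP; rewrite lt0n; apply/negP => /eqP xv.
have /and3P[cD nD /forall_inP/(_ v vDP)] := nz.
rewrite xv addn0 /= => /andP[dv cv].
have [vP vD] := setDP vDP; have [zK' zP] := setDP zK.
have vK := subsetP (side_sub cD) v vP.
have zv : z != v by apply: contraTneq vP => <-; apply: side_notin cD.
have [A [cA nA _ zA]] := cut_side z cv.
have sAD : A \subset D.
  apply/subsetP => u uA; apply/negPn/negP => uD.
  have uK : u \in K by have /closedP[/subsetP/(_ u uA)] := cA; rewrite !inE => /andP[].
  have sK : K :\: D \subset K :\ v.
    by apply/subsetP => w; rewrite !inE => /andP[wD ->]; rewrite andbT; apply: contraNneq wD => ->.
  have uKD : u \in K :\: D by rewrite inE uD.
  have /subsetP/(_ z) := conn_sub cA (conn_del cK zK' cD) sK uA uKD.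
  by rewrite inE zK' (side_notin cD) (negPf zA) => /(_ isT).
have pr : A \proper D.
  by apply/properP; split=> //; exists v => //; apply: side_notin cA.
have /minD /= : cand (v, A).
  rewrite /cand /= !inE vD vK xv eqxx dv implybT /=.
  apply/and3P; split=> //; apply/forall_inP => w; rewrite inE => /andP[wP wA].
  by have /and3P[_ _ /forall_inP] := nz; apply; rewrite inE wP (subsetP sAD).
by rewrite leqNgt proper_card.
Qed.

(* A set [P = [set a]] holds a root, exempt from all conditions; the bounds without a root, with a
   root of degree at most 1 and with a root of larger degree differ by constants only, recorded in
   [slack].  Induction removes an innermost nice side [D] of some [z], all of whose vertices then
   have positive weight; if only one neighbour [y] of [z] is left, [z] goes as well and [y] gains
   one unit of weight in exchange for the lost edge. *)
Lemma nice_count K P x Z :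
    conn K -> (P = set0 \/ exists2 a, a \in K & P = [set a]) -> Z \subset K :\: P ->
    (forall z, z \in Z -> [/\ x z = 0, P != set0 -> 3 <= dgin K z & exists D, nice K P x z D]) ->
    Z != set0 ->
  #|Z| + slack K P <= (\sum_(v in K :\: P) x v).*2.+1.
Proof.
have [n] := ubnP #|K|; elim: n => // n IH in K P x Z * => leKn cK rP sZ hZ nZ.
have [w0 w0Z] := set0Pn _ nZ; have [xw0 dw0 [D0 nD0]] := hZ _ w0Z.
have [z [D [/setDP[zK zP] xz dz nz pos]]] := min_nice cK (subsetP sZ _ w0Z) xw0 dw0 nD0.
have /and3P[cD nD /forall_inP gD] := nz.
have sDK := side_sub cD; have zD := side_notin cD.
have ZD w : w \in Z -> w \notin D.
  move=> wZ; apply/negP => wD; have [xw _ _] := hZ _ wZ.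
  have := subsetP sZ _ wZ; rewrite inE => /andP[wP _].
  by have := pos w; rewrite inE wP wD xw => /(_ isT).
have inK w : w \in Z -> [/\ w \in K, w \notin P & w \notin D].
  by move=> wZ; have := subsetP sZ _ wZ; rewrite inE => /andP[-> ->]; rewrite ZD.
have ltK : #|K :\: D| < #|K|.
  case/set0Pn: nD => u uD; apply: proper_card; apply/properP; split; first exact: subsetDl.
  by exists u; [exact: (subsetP sDK)|rewrite inE uD].
have cK' := conn_del cK zK cD.
have zK' : z \in K :\: D by rewrite inE zD.
have ltn' : #|K :\: D| < n by rewrite -ltnS; apply: leq_trans leKn.
have esum := sum_side x P sDK.
set e := \sum_(v in K :\: P) x v in esum *.
set eD := \sum_(v in D :\: P) x v in esum.
have posD := sum_pos_card pos; rewrite -/eD in posD.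
have slackP : slack K P <= 3.
  by rewrite /slack; case: rP => [->|[a _ ->]]; rewrite ?eqxx // big_set1; case: ifP => // _; case: (1 < _).
have [PD|PD] := boolP (P :&: D == set0); last first.
  (* The root lies in [D]: remove [D] and take [z] as the new root. *)
  have [a aK Pa] : exists2 a, a \in K & P = [set a].
    by case: rP => // P0; rewrite P0 set0I eqxx in PD.
  have aD : a \in D.
    by case/set0Pn: PD => u; rewrite Pa !inE => /andP[/eqP ->].
  have dz3 : 3 <= dgin K z by apply: dz; rewrite Pa; apply/set0Pn; exists a; rewrite set11.
  have IHz := IH (K :\: D) [set z] x (Z :\ z) ltn' cK'.
  have {IHz} IHz : Z :\ z != set0 ->
      #|Z :\ z| + (1 < dgin (K :\: D) z) <= (\sum_(v in (K :\: D) :\: P) x v).*2.+1.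
    move=> nZ'; have -> : \sum_(v in (K :\: D) :\: P) x v = \sum_(v in (K :\: D) :\: [set z]) x v.
      rewrite (bigD1 z) /= ?xz ?inE ?zP ?zD ?zK //; apply: eq_bigl => v.
      rewrite !inE; case: (eqVneq v z); rewrite /= ?andbF ?andbT //.
      by move=> _; rewrite Pa inE; case: eqVneq => //= ->; rewrite aD.
    rewrite -slack1; apply: IHz => //; first by right; exists z.
      apply/subsetP => w; rewrite !inE => /andP[-> /inK[-> _ ->]] //.
    move=> w /setD1P[wz wZ]; have [wK wP wD] := inK _ wZ.
    have [xw dw [E nE]] := hZ _ wZ; split=> //.
      move=> _; rewrite (dgin_remove cD) //; apply: dw.
      by rewrite Pa; apply/set0Pn; exists a; rewrite set11.
    exists (E :\: D); apply: (@nice_remove _ K z D P) nE => //.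
      move=> v; rewrite inE Pa !inE => /andP[vD _] /eqP va; by rewrite va aD in vD.
    by left; rewrite inE.
  have dsp : dgin K z = dgin D z + dgin (K :\: D) z by apply: dgin_split.
  have sl : slack K P = (1 < dgin K a) by rewrite Pa slack1.
  (* If [D] is the root alone, [a] has degree at most 1 and no slack, while [z] keeps two neighbours
     and supplies slack 1. Otherwise the weight in [D] pays for [z] and the slack. *)
  have [Da|Da] := boolP (D == [set a]).
    have dz1 : dgin D z <= 1 by rewrite (eqP Da) /dgin (leq_trans (subset_leq_card (subsetIr _ _))) ?cards1.
    have da : dgin K a <= 1.
      rewrite -(cards1 z); apply: subset_leq_card; apply/subsetP => u; rewrite !inE => /andP[au uK].
      have ua := adj_neq au; apply: contraTT au => uz; apply: (side_nadj cD aD uK uz).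
      by rewrite (eqP Da) inE eq_sym.
    have := cards_rem1 Z z; rewrite sl ltnNge da /= addn0.
    have [Z0|/IHz] := eqVneq (Z :\ z) set0; first by rewrite Z0 cards0; move: #|Z|; clear; lia.
    have -> : 1 < dgin (K :\: D) z by move: dsp dz3 dz1; clear; lia.
    by move: esum; clear; lia.
  have eD1 : 0 < eD.
    apply: leq_trans posD; rewrite card_gt0; apply/set0Pn.
    have : ~~ (D \subset [set a]).
      by apply: contra Da => sD; rewrite eqEsubset sD sub1set aD.
    by case/subsetPn => u uD ua; exists u; rewrite inE uD Pa ua.
  have := cards_rem1 Z z; rewrite sl.
  have [Z0|/IHz] := eqVneq (Z :\ z) set0; first by rewrite Z0 cards0; move: esum eD1 (leq_b1 (1 < dgin K a)); clear; lia.
  by move: esum eD1 (leq_b1 (1 < dgin K a)); clear; lia.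
have DP v : v \in D -> v \notin P.
  by move=> vD; apply/negP => vP; move/eqP/setP/(_ v): PD; rewrite !inE vP vD.
(* The neighbours of [v] in [K] lie in [z |: D], so [#|D|] is at least the degree of [v]. The other
   vertices of [D] add at least [#|D| - 1] to [x v], and degree plus weight of [v] is at least 3. *)
have eD2 : 2 <= eD.
  have [v vD] := set0Pn _ nD.
  have := gD v; rewrite inE (DP _ vD) vD => /(_ isT)/andP[dv _].
  have dvD : dgin K v <= #|D|.
    have -> : #|D| = #|z |: (D :\ v)| by rewrite cardsU1 !inE (negPf zD) andbF (cardsD1 v D) vD.
    apply: subset_leq_card; apply/subsetP => u; rewrite !inE => /andP[vu uK].
    have [//|uz /=] := eqVneq u z; rewrite eq_sym (adj_neq vu) /=.
    by apply: contraTT vu => uD; apply: side_nadj uK uz uD.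
  have -> : eD = x v + \sum_(u in D :\ v) x u.
    rewrite /eD (bigD1 v) /= ?inE ?(DP _ vD) //; congr (_ + _); apply: eq_bigl => u.
    by rewrite !inE; case: (boolP (u \in D)) => [/DP ->|]; rewrite ?andbF ?andbT.
  have : #|D :\ v| <= \sum_(u in D :\ v) x u.
    by apply: sum_pos_card => u; rewrite inE => /andP[_ uD]; apply: pos; rewrite inE DP.
  by have := cardsD1 v D; rewrite vD; move: dv dvD; clear; lia.
have rP' U : D \subset U -> U \subset K -> U :&: P = set0 ->
    (P = set0 \/ exists2 a, a \in K :\: U & P = [set a]).
  move=> _ _ UP; case: rP => [->|[a aK Pa]]; [by left|right; exists a => //].
  by rewrite inE aK andbT; apply/negP => aU; move/setP/(_ a): UP; rewrite Pa !inE aU eqxx.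
have DP0 : D :&: P = set0 by rewrite setIC; apply/eqP.
have slack_rm U : (forall a, a \in P -> dgin (K :\: U) a = dgin K a) -> slack (K :\: U) P = slack K P.
  by move=> h; rewrite /slack; case: ifP => // _; apply: eq_bigr => a /h ->.
have aDz a : a \in P -> a != z by move=> aP; apply: contraNneq zP => <-.
have PK a : a \in P -> a \in K by case: rP => [->|[b bK ->]]; rewrite inE // => /eqP ->.
have PnD a : a \in P -> a \notin D by move=> aP; apply/negP => /DP; rewrite aP.
have [d1|d1] := ltnP 1 (dgin (K :\: D) z).
  (* Replace [D] by a single unit of weight at [z]. *)
  have sl : slack (K :\: D) P = slack K P.
    by apply: slack_rm => a aP; rewrite (dgin_remove cD) ?PK ?aDz ?PnD.
  have IHz := IH (K :\: D) P (bump x z) (Z :\ z) ltn' cK' (rP' _ (subxx _) sDK DP0).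
  have [Z0|nZ'] := eqVneq (Z :\ z) set0.
    by have := cards_rem1 Z z; rewrite Z0 cards0; move: esum eD2 slackP; clear; lia.
  have {IHz} := IHz _ _ nZ'; rewrite sl sum_bump ?inE ?zP ?zD ?zK // => IHz.
  have := cards_rem1 Z z; suff : #|Z :\ z| + slack K P <= ((\sum_(v in (K :\: D) :\: P) x v).+1).*2.+1.
    by move: esum eD2; clear; lia.
  apply: IHz.
    by apply/subsetP => w; rewrite !inE => /andP[_ /inK[-> -> ->]].
  move=> w /setD1P[wz wZ]; have [wK wP wD] := inK _ wZ.
  have [xw dw [E nE]] := hZ _ wZ; split; first by rewrite bump_neq.
    by rewrite (dgin_remove cD).
  exists (E :\: D); apply: (@nice_remove _ K z D P) nE => //.
    by move=> v; apply: bump_neq.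
  by right; rewrite /bump eqxx; split=> // _ _; move: d1; clear; lia.
have nD' : z |: D != set0 by apply/set0Pn; exists z; rewrite setU11.
(* At most one neighbour of [z] is left. If there is none, [K :\: D] is [z] alone and the weight of
   [D] suffices. *)
have [y yn|ny] := pickP (mem (nbr z :&: (K :\: D))); last first.
  have Kz : K :\: D = [set z].
    symmetry; apply: (connP _ cK'); last by apply/set0Pn; exists z; rewrite set11.
    apply/closedP; split; first by rewrite sub1set.
    move=> u v /set1P -> vK zv; have := ny v; by rewrite /= !inE zv /= -in_setD vK.
  have Zz : Z \subset [set z].
    by rewrite -Kz; apply/subsetP => w /inK[wK _ wD]; rewrite inE wK wD.
  have := subset_leq_card Zz; rewrite cards1; move: esum eD2 slackP; clear; lia.
have := yn; rewrite /= !inE => /and3P[zy yD yK].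
have yz : y != z by rewrite eq_sym adj_neq.
have nzy u : u \in K -> u \notin D -> adj z u -> u = y.
  move=> uK uD zu; apply/eqP/contraT => uy.
  have : [set u; y] \subset nbr z :&: (K :\: D).
    by apply/subsetP => v; rewrite !inE => /orP[] /eqP ->; rewrite ?zu ?zy ?uK ?uD ?yD ?yK.
  by move/subset_leq_card; rewrite cards2 uy leqNgt ltnS; rewrite /dgin in d1; rewrite d1.
set E0 := z |: D.
have sEK : E0 \subset K by rewrite subUset sub1set zK.
have yE : y \notin E0 by rewrite !inE negb_or yz.
have cE0 : closed_in E0 (K :\ y).
  apply/closedP; split.
    apply/subsetP => u uE; rewrite !inE (subsetP sEK) // andbT.
    by apply: contraNneq yE => <-.
  move=> u v uE; rewrite in_setD1 => /andP[vy vK] uv; rewrite !inE.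
  have [//|vz /=] := eqVneq v z; apply/negPn/negP => vD.
  move: uE; rewrite !inE => /orP[/eqP uz|uD].
    by rewrite uz in uv; rewrite (nzy v) ?eqxx in vy.
  by have := side_nadj cD uD vK vz vD; rewrite uv.
have cK2 := conn_del cK yK cE0.
have ltn2 : #|K :\: E0| < n.
  by apply: leq_trans ltn'; rewrite ltnS; apply/subset_leq_card/setDS/subsetUr.
have EP0 : E0 :&: P = set0.
  apply/setP => u; rewrite !inE; apply/negbTE; apply/negP => /andP[/orP[/eqP ->|/DP uD] uP].
    by rewrite uP in zP.
  by rewrite uP in uD.
have IHz := IH (K :\: E0) P (bump x y) (Z :\ z :\ y) ltn2 cK2 (rP' _ (subsetUr _ _) sEK EP0).
have esum2 := sum_side x P sEK; rewrite -/e in esum2.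
have eE : \sum_(v in E0 :\: P) x v = eD.
  rewrite (bigD1 z) /= ?xz; last by rewrite !inE eqxx zP.
  apply: eq_bigl => v; rewrite !inE; case: (eqVneq v z) => [->|]; rewrite ?(negPf zD) ?andbF ?andbT //.
rewrite eE in esum2.
(* The slack drops by at most 1, and only if [y] is the root; then [y] is not in [Z], so the two
   losses never add up. *)
have slk : slack K P + (y \in Z) <= slack (K :\: E0) P + 1.
  have [yP|yP] := boolP (y \in P).
    have -> : (y \in Z) = false by apply/negP => /inK[_]; rewrite yP.
    case: rP => [P0|[a aK Pa]]; first by rewrite P0 inE in yP.
    by rewrite Pa !slack1; case: (1 < _); case: (1 < _).
  rewrite slack_rm; first by move: (leq_b1 (y \in Z)); clear; lia.
  move=> a aP; apply: (dgin_remove cE0); rewrite ?PK //.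
    by apply: contraNneq yP => <-.
  by rewrite !inE negb_or aDz // PnD.
have := cards_rem2 Z z y.
have [Z0|nZ'] := eqVneq (Z :\ z :\ y) set0; first by rewrite Z0 cards0; move: (leq_b1 (y \in Z)) esum2 eD2 slackP; clear; lia.
suff : #|Z :\ z :\ y| + slack (K :\: E0) P <= (\sum_(v in (K :\: E0) :\: P) bump x y v).*2.+1.
  by have := sum_bump_le x y ((K :\: E0) :\: P); move: esum2 eD2 slk; clear; lia.
apply: IHz => //.
  apply/subsetP => w; rewrite !inE => /and3P[_ wz /inK[wK wP wD]].
  by rewrite wP wK negb_or wz wD.
move=> w; rewrite !inE => /and3P[wy wz wZ]; have [wK wP wD] := inK _ wZ.
have wE : w \notin E0 by rewrite !inE negb_or wz.
have [xw dw [E nE]] := hZ _ wZ; split; first by rewrite bump_neq.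
  by rewrite (dgin_remove cE0).
exists (E :\: E0); apply: (@nice_remove _ K y E0 P) nE => //.
  by move=> v; apply: bump_neq.
have [yP|yP] := boolP (y \in P); [by left|right].
rewrite /bump eqxx; split=> // _.
suff : dgin E0 y <= 1 by have := dgin_split y sEK; clear; lia.
rewrite -(cards1 z); apply: subset_leq_card; apply/subsetP => u; rewrite !inE => /andP[yu].
case/orP => // uD; have := side_nadj cD uD yK yz yD; by rewrite adj_sym yu.
Qed.

End NiceCount.

(** * Uncolourable sets with tight lists *)

Section Bad.
Variables (G : sgraph) (D : finType) (d0 : D).
Implicit Types (A B H : {set G}) (u v w z : G) (L : G -> {set D}) (c : D).

Definition colorable H L : bool :=
  [exists f : {ffun G -> D},
     [forall v in H, (f v \in L v) && [forall u in H, adj v u ==> (f v != f u)]]].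

Lemma colorableP H L :
  reflect (exists2 f : G -> D, {in H, forall v, f v \in L v} &
             {in H &, forall u v, adj u v -> f u != f v}) (colorable H L).
Proof.
apply: (iffP existsP) => [[f /forall_inP hf]|[f fL fa]].
  exists f => [v /hf /andP[]//|u v /hf/andP[_ /forall_inP hu] vH uv].
  exact: (implyP (hu v vH)).
exists (finfun f); apply/forall_inP => v vH; rewrite !ffunE fL //=.
by apply/forall_inP => u uH; rewrite ffunE; apply/implyP/fa.
Qed.

Lemma eq_colorable H L L' : {in H, L =1 L'} -> colorable H L = colorable H L'.
Proof.
move=> e; apply/colorableP/colorableP => -[f fL fa]; exists f => // v vH; move: (fL v vH);
by rewrite e.
Qed.

Lemma colorable_split A U L : closed_in A U -> colorable A L -> colorable (U :\: A) L -> colorable U L.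
Proof.
move=> cA /colorableP[f fL fa] /colorableP[g gL ga]; apply/colorableP.
exists (fun v => if v \in A then f v else g v) => [v vU|u v uU vU uv].
  by case: ifPn => vA; [apply: fL|apply: gL; rewrite inE vA].
have av : adj v u by rewrite adj_sym.
case: ifPn => uA; case: ifPn => vA.
- exact: fa.
- by have := closed_nadj cA uA vU vA; rewrite uv.
- by have := closed_nadj cA vA uU uA; rewrite av.
- by apply: ga; rewrite ?inE ?uA ?vA.
Qed.

Definition del_color L z c : G -> {set D} := fun v => if adj z v then L v :\ c else L v.

Lemma colorable_extend H L z c : c \in L z -> colorable (H :\ z) (del_color L z c) -> colorable H L.
Proof.
move=> cL /colorableP[f fL fa]; apply/colorableP.
exists (fun v => if v == z then c else f v) => [v vH|u v uH vH uv].
  case: eqVneq => [->//|vz]; have := fL v; rewrite !inE vz vH => /(_ isT).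
  by rewrite /del_color; case: ifP => // _; rewrite inE => /andP[].
have fc w : w \in H -> w != z -> adj z w -> f w != c.
  move=> wH wz zw; have := fL w; rewrite !inE wz wH => /(_ isT).
  by rewrite /del_color zw !inE => /andP[].
case: (eqVneq u z) uv => [->|uz] uv; case: (eqVneq v z) uv => [->|vz] uv.
- by rewrite adj_irrefl in uv.
- by rewrite eq_sym fc //.
- by rewrite fc // adj_sym.
- by apply: fa; rewrite ?inE ?uz ?vz.
Qed.

Lemma card_del_color L z c v : #|L v| <= #|del_color L z c v| + adj z v.
Proof.
rewrite /del_color; case: ifP => _; rewrite ?addn0 //.
by rewrite (cardsD1 c) addnC leq_add2l leq_b1.
Qed.

Lemma dgin_D1 H z v : z \in H -> dgin H v = dgin (H :\ z) v + adj v z.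
Proof.
move=> zH; rewrite (@dgin_split _ (H :\ z)) ?subsetDl //; congr (_ + _).
have -> : H :\: (H :\ z) = [set z].
  by apply/setP => u; rewrite !inE negb_and negbK; case: eqVneq => [->|] //=; rewrite ?zH //; case: (u \in H).
rewrite /dgin; case: (boolP (adj v z)) => vz.
  suff -> : nbr v :&: [set z] = [set z] by rewrite cards1.
  by apply/setIidPr; rewrite sub1set inE.
apply/eqP; rewrite cards_eq0; apply/eqP/setP => u; rewrite !inE.
by apply/negbTE; apply: contra vz => /andP[vu /eqP <-].
Qed.

(* Colour a vertex with a spare colour last: its neighbours then have a spare colour without it. *)
Lemma surplus_colorable H L :
  {in H, forall v, dgin H v <= #|L v|} ->
  (forall A, closed_in A H -> A != set0 -> exists2 v, v \in A & dgin H v < #|L v|) ->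
  colorable H L.
Proof.
have [n] := ubnP #|H|; elim: n => // n IH in H L * => ltn dL sL.
have [H0|nH] := eqVneq H set0.
  by apply/colorableP; exists (fun=> d0) => [v|u v]; rewrite H0 inE.
have [z zH zL] : exists2 z, z \in H & dgin H z < #|L z|.
  by apply: sL => //; apply/closedP.
have {}ltn : #|H :\ z| < n by rewrite (cardsD1 z) zH in ltn.
have : colorable (H :\ z) L.
  apply: IH => // [v /setD1P[vz vH]|A cA nA].
    by apply: leq_trans (dL v vH); apply/dginS/subsetDl.
  have [zA|zA] := boolP (closed_in A H).
    have [v vA vL] := sL A zA nA; exists v => //.
    by apply: leq_ltn_trans vL; apply/dginS/subsetDl.
  have /closedP[sA cA'] := cA.
  have [/exists_inP[v vA zv]|nz] := boolP [exists v in A, adj v z].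
    exists v => //; have := subsetP sA v vA; rewrite !inE => /andP[_ /dL].
    by rewrite (dgin_D1 _ zH) zv addn1.
  case/negP: zA; apply/closedP; split; first exact: subset_trans sA (subsetDl _ _).
  move=> u v uA vH uv; apply: (cA' u) => //; rewrite !inE vH andbT.
  by apply: contraNneq nz => <-; apply/exists_inP; exists u.
case/colorableP=> f fL fa.
have [c cL cf] : exists2 c, c \in L z & c \notin f @: (nbr z :&: H).
  have : ~~ (L z \subset f @: (nbr z :&: H)).
    apply: contraL zL => /subset_leq_card le; rewrite -leqNgt.
    by apply: leq_trans le (leq_imset_card _ _).
  by case/subsetPn => c; exists c.
apply: (@colorable_extend _ _ z c) => //; apply/colorableP; exists f => // v /setD1P[vz vH].
have fv : f v \in L v by apply: fL; rewrite !inE vz.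
rewrite /del_color; case: ifP => // zv; rewrite inE fv andbT inE.
by apply: contraNneq cf => <-; apply: imset_f; rewrite !inE zv.
Qed.

(** The connected obstructions to degree-choosability, as in the theorem of Gallai and of Erdos,
    Rubin and Taylor. *)
Definition bad H L : Prop :=
  [/\ conn H, {in H, forall v, dgin H v <= #|L v|} & ~~ colorable H L].

Lemma conn_surplus_colorable H L v : conn H -> {in H, forall v, dgin H v <= #|L v|} ->
  v \in H -> dgin H v < #|L v| -> colorable H L.
Proof.
move=> cH dL vH vL; apply: surplus_colorable => // A cA nA.
by exists v => //; rewrite (connP _ cH A cA nA).
Qed.

Lemma bad_tight H L v : bad H L -> v \in H -> #|L v| = dgin H v.
Proof.
move=> [cH dL ncol] vH; apply/eqP; rewrite eqn_leq dL // andbT leqNgt.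
by apply: contra ncol; apply: conn_surplus_colorable.
Qed.

Lemma bad_del H L v c : bad H L -> v \in H -> conn (H :\ v) -> c \in L v ->
  bad (H :\ v) (del_color L v c).
Proof.
move=> [cH dL ncol] vH cHv cL; split=> //; last by apply: contra ncol; apply: colorable_extend.
move=> u /setD1P[uv uH]; have := dL u uH; have := card_del_color L v c u.
by rewrite (dgin_D1 u vH) (adj_sym u); case: (adj v u); lia.
Qed.

(** Giving [v] a colour missing at [u] would lower the degree of [u] but not its list, so [H :\ v]
    would not be tight. *)
Lemma bad_sub H L v u : bad H L -> v \in H -> conn (H :\ v) -> u \in H -> adj v u ->
  L v \subset L u.
Proof.
move=> bH vH cHv uH vu; apply/subsetP => c cL.
have uHv : u \in H :\ v by rewrite !inE eq_sym adj_neq.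
have := bad_tight (bad_del bH vH cHv cL) uHv; have := bad_tight bH uH.
rewrite (dgin_D1 u vH) (adj_sym u) vu /del_color vu (cardsD1 c (L u)).
by case: (c \in L u) => //; lia.
Qed.

(* The colours at [z] that cannot be extended to [A] number at most [dgin A z], for otherwise
   [z |: A], with the list of [z] restricted to them, would be colourable; as every colour at [z]
   fails on [A] or on the other side, both bounds are attained. *)
Lemma bad_side H L z A : bad H L -> z \in H -> closed_in A (H :\ z) ->
  exists2 M : {set D}, #|M| = dgin A z & bad (z |: A) (fun v => if v == z then M else L v).
Proof.
move=> bH zH cA; have [cH dL ncol] := bH.
pose M B := [set c in L z | ~~ colorable B (del_color L z c)].
have main B : closed_in B (H :\ z) ->
    #|M B| <= dgin B z /\ (dgin B z <= #|M B| ->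
    bad (z |: B) (fun v => if v == z then M B else L v)).
  move=> cB; have cBz := conn_addS cH zH cB; have zB := side_notin cB.
  have sBH := side_sub cB.
  have dB v : v \in B -> dgin (z |: B) v = dgin H v.
    move=> vB; apply: dgin_eq; first by rewrite subUset sub1set zH.
    move=> u uH vu; rewrite !inE; case: eqVneq => //= uz; apply: contraTT vu => uB.
    exact: (side_nadj cB).
  have dz : dgin (z |: B) z = dgin B z.
    rewrite (dgin_D1 z (setU11 z B)) adj_irrefl addn0; congr (dgin _ z).
    by rewrite setU1K.
  have nc : ~~ colorable (z |: B) (fun v => if v == z then M B else L v).
    apply/negP => /colorableP[f fL fa]; have := fL z (setU11 _ _); rewrite eqxx inE => /andP[_ /negP]; apply.
    apply/colorableP; exists f => [v vB|u v uB vB]; last by apply: fa; rewrite !inE ?uB ?vB orbT.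
    have vz : v != z by apply: contraTneq vB => ->.
    have vBz : v \in z |: B by rewrite inE vB orbT.
    have := fL v vBz; rewrite (negPf vz) /del_color => fv; case: ifP => // zv.
    by rewrite inE fv andbT inE eq_sym; apply: fa => //; rewrite setU11.
  have dM : dgin B z <= #|M B| -> {in z |: B, forall v, dgin (z |: B) v <= #|if v == z then M B else L v|}.
    move=> dzM v; rewrite !inE; case: eqVneq => [->|vz /= vB]; first by rewrite dz.
    by rewrite dB // dL // (subsetP sBH).
  split; last by move=> le; split=> //; apply: dM.
  rewrite leqNgt; apply: contra nc => lt; apply: (@conn_surplus_colorable _ _ z); rewrite ?setU11 //.
    exact/dM/ltnW.
  by rewrite eqxx dz.
have [leA bA] := main A cA.
have [leB _] := main _ (closedD cA).
have le : dgin A z <= #|M A|.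
  move: leB; have : #|L z| <= #|M A| + #|M ((H :\ z) :\: A)|.
    rewrite -cardsUI (leq_trans _ (leq_addr _ _)) //; apply/subset_leq_card/subsetP => c cL.
    rewrite !inE cL /= -negb_and; apply: contra ncol => /andP[c1 c2].
    by apply: (colorable_extend cL); apply: colorable_split c1 c2.
  rewrite (bad_tight bH zH) (dgin_D1 z zH) adj_irrefl addn0.
  rewrite (@dgin_split _ A (H :\ z)) //; last by have /closedP[] := cA.
  by move: #|M A| #|M _|; clear; lia.
by exists (M A); [apply/eqP; rewrite eqn_leq leA|apply: bA].
Qed.

End Bad.

(** * Cut vertices, deficits and regularity of bad sets *)

Section BadStructure.
Variables (G : sgraph) (D : finType) (d0 : D).
Implicit Types (A B H : {set G}) (u v w z : G) (L : G -> {set D}) (c : D).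

(** The other sides of [u] are still sides of [u] in [H :\ v], and deleting them leaves a connected
    set. *)
Lemma conn_side_del H u v A : conn H -> u \in H -> closed_in A (H :\ u) ->
  v \in A -> conn (H :\ v) -> conn ((u |: A) :\ v).
Proof.
move=> cH uH cA vA cHv; have sA := side_sub cA.
have vu : v != u by apply: contraTneq vA => ->; apply: side_notin cA.
have cB : closed_in ((H :\ u) :\: A) ((H :\ v) :\ u).
  apply: closed_sub (closedD cA) _ _; last first.
    by apply/subsetP => w; rewrite !inE => /and3P[-> _ ->].
  apply/subsetP => w; rewrite !inE => /and3P[wA -> ->]; rewrite andbT.
  by apply: contraNneq wA => ->.
suff -> : (u |: A) :\ v = (H :\ v) :\: ((H :\ u) :\: A).
  by apply: conn_del cHv _ cB; rewrite !inE eq_sym vu.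
apply/setP => w; rewrite !inE; have := subsetP sA w.
have [->|wv] := eqVneq w v; rewrite ?andbF //=.
have [->|wu] := eqVneq w u; rewrite ?uH ?andbF //=.
by case: (w \in A) => [/(_ isT) ->|_] //=; case: (w \in H).
Qed.

Variables (H : {set G}) (L : G -> {set D}) (m : nat).
Hypotheses (bH : bad H L) (Hm : {in H, forall v, dgin H v <= m})
  (Hlt : exists2 w, w \in H & dgin H w < m).

(* If a non-cut vertex has degree [m], all lists around it coincide with its own, of size [m]; a
   neighbouring cut vertex would need a list of size less than [m] towards it.  So all of
   [H] is [m]-regular. *)
Lemma bad_noncut v : v \in H -> conn (H :\ v) -> dgin H v < m.
Proof.
move=> vH cHv; rewrite ltnNge; apply/negP => mv.
have [cH dL ncol] := bH.
pose U := [set v in H | conn (H :\ v) && (dgin H v == m)].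
have cU : closed_in U H.
  apply/closedP; split; first by apply/subsetP => u; rewrite inE => /andP[].
  move=> {mv cHv vH}v u; rewrite !inE => /and3P[vH cHv /eqP dv] uH vu.
  have sL := bad_sub d0 bH vH cHv uH vu.
  have cLu : #|L u| <= #|L v| by rewrite !(bad_tight d0 bH) // dv Hm.
  have eL : L v = L u by apply/eqP; rewrite eqEcard sL cLu.
  have du : dgin H u = m by rewrite -(bad_tight d0 bH uH) -eL (bad_tight d0 bH vH).
  rewrite uH du eqxx andbT; apply/negPn/negP => ncu.
  have [A' [cA' nA' nC' _]] := cut_side v ncu.
  have vHu : v \in H :\ u by rewrite !inE adj_neq.
  have [A [cA vA nC]] : exists A, [/\ closed_in A (H :\ u), v \in A & (H :\ u) :\: A != set0].
    have [vA'|vA'] := boolP (v \in A'); first by exists A'.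
    exists ((H :\ u) :\: A'); split; [exact: closedD|by rewrite in_setD vA'|].
    by rewrite setDDr setDv set0U (setIidPr _) //; have /closedP[] := cA'.
  have [M cM bM] := bad_side d0 bH uH cA.
  have vuA : v \in u |: A by rewrite inE vA orbT.
  have vneu : v != u by rewrite adj_neq.
  (* The [m] colours of [L v] would all lie in [M], which has fewer because [u] also has a neighbour
     outside [A]. *)
  have := bad_sub d0 bM vuA (conn_side_del cH uH cA vA cHv) (setU11 _ _) vu.
  rewrite eqxx (negPf vneu) => /subset_leq_card; rewrite cM.
  rewrite (bad_tight d0 bH vH) dv -du (dgin_D1 u uH) adj_irrefl addn0.
  rewrite (@dgin_split _ A (H :\ u)) //; last by have /closedP[] := cA.
  have : 0 < dgin ((H :\ u) :\: A) u.
    by rewrite dgin_gt0; have [w wC uw] := conn_nbr cH uH (closedD cA) nC; apply/exists_inP; exists w.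
  by clear; lia.
have vU : v \in U by rewrite inE vH cHv eqn_leq Hm.
have UH : U = H by apply: (connP _ cH U cU); apply/set0Pn; exists v.
case: Hlt => w wH; have : w \in U by rewrite UH.
by rewrite inE => /and3P[_ _ /eqP ->]; rewrite ltnn.
Qed.

(** Pass to an innermost side, free of cut vertices. There a vertex of degree [d] and its neighbours
    in the side have lists of equal size, hence equal deficits [m - d]. They number at least [d],
    since only [z] can be a neighbour outside, and [d * (m - d)] is at least [m - 1]. *)
Lemma bad_side_weight z A : z \in H -> closed_in A (H :\ z) -> A != set0 ->
  m <= (\sum_(v in A) (m - dgin H v)).+1.
Proof.
move=> zH; have [n] := ubnP #|A|; elim: n => // n IH in z zH A * => ltn cA nA.
have [cH dL ncol] := bH; have sA := side_sub cA; have zA := side_notin cA.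
have [/exists_inP[v vA ncv]|] := boolP [exists v in A, ~~ conn (H :\ v)].
  have vH := subsetP sA v vA.
  have [B [cB nB _ zB]] := cut_side z ncv.
  have sBA : B \subset A.
    apply/subsetP => u uB; apply/negPn/negP => uA.
    have uH : u \in H :\: A by rewrite inE uA (subsetP (side_sub cB)).
    have sHA : H :\: A \subset H :\ v.
      by apply/subsetP => w; rewrite !inE => /andP[wA ->]; rewrite andbT; apply: contraNneq wA => ->.
    have /subsetP/(_ z) := conn_sub cB (conn_del cH zH cA) sHA uB uH.
    by rewrite inE zH zA (negPf zB) => /(_ isT).
  have prB : B \proper A.
    by apply/properP; split=> //; exists v => //; apply: side_notin cB.
  have ltB : #|B| < n by apply: leq_trans (proper_card prB) _; rewrite -ltnS.
  apply: leq_trans (IH v vH B ltB cB nB) _.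
  by rewrite ltnS [leqRHS](big_setID B) /= (setIidPr sBA) leq_addr.
rewrite negb_exists_in => /forall_inP nc.
have {}nc u : u \in A -> conn (H :\ u) by move/nc; rewrite negbK.
have [v vA] := set0Pn _ nA; have vH := subsetP sA v vA.
have lt := bad_noncut vH (nc v vA).
have vz : v != z by apply: contraTneq vA => ->.
have d1 : 0 < dgin H v.
  rewrite dgin_gt0.
  have [||u] := @conn_nbr _ H v (H :\ v) cH vH; last by move=> /setD1P[_ uH] vu; apply/exists_inP; exists u.
    exact/closedP.
  by apply/set0Pn; exists z; rewrite !inE eq_sym vz.
pose N := v |: (nbr v :&: A).
have cN : dgin H v <= #|N|.
  rewrite cardsU1 !inE adj_irrefl /= add1n.
  rewrite (dgin_D1 v zH) -addn1; apply: leq_add; last exact: leq_b1.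
  rewrite -/(dgin A v) -(@dgin_eq _ A (H :\ z)) //; first by have /closedP[] := cA.
  move=> u; rewrite !inE => /andP[uz uH]; apply: contraTT => uA; exact: (side_nadj cA).
have eN u : u \in N -> m - dgin H u = m - dgin H v.
  rewrite !inE => /orP[/eqP -> //|/andP[vu uA]]; have uH := subsetP sA u uA.
  have uv : adj u v by rewrite adj_sym.
  have := subset_leq_card (bad_sub d0 bH vH (nc v vA) uH vu).
  have := subset_leq_card (bad_sub d0 bH uH (nc u uA) vH uv).
  by rewrite !(bad_tight d0 bH) // => l1 l2; congr (_ - _); apply/eqP; rewrite eqn_leq l1.
have sNA : N \subset A by rewrite subUset sub1set vA subsetIr.
rewrite (big_setID N) /= (setIidPr sNA) (eq_bigr _ eN) sum_nat_const.
move: cN d1 lt; move: (dgin H v) #|N| (\sum_(i in _) _) => d k s dk d1 dm.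
have : d * (m - d) <= k * (m - d) by rewrite leq_mul2r dk orbT.
(* With [e = m - d] this says [0 <= (d - 1) * (e - 1)]. *)
suff : m <= (d * (m - d)).+1 by clear; lia.
have -> : m = d + (m - d) by rewrite subnKC // ltnW.
rewrite addKn; have : 0 < m - d by rewrite subn_gt0.
move: d1; clear; move: (m - d) => e; case: d e => [|d] [|e] // _ _; nia.
Qed.

Lemma bad_regular : (forall v, v \in H -> conn (H :\ v)) ->
  {in H &, forall u v, dgin H u = dgin H v}.
Proof.
move=> nc u v uH vH; have [cH dL ncol] := bH.
pose U := [set w in H | dgin H w == dgin H u].
suff UH : U = H by move: vH; rewrite -{1}UH inE => /andP[_ /eqP].
apply: (connP _ cH); last by apply/set0Pn; exists u; rewrite inE uH eqxx.
apply/closedP; split; first by apply/subsetP => w; rewrite inE => /andP[].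
move=> w y; rewrite !inE => /andP[wH /eqP <-] yH wy; rewrite yH /=.
have yw : adj y w by rewrite adj_sym.
have := subset_leq_card (bad_sub d0 bH wH (nc w wH) yH wy).
have := subset_leq_card (bad_sub d0 bH yH (nc y yH) wH yw).
by rewrite !(bad_tight d0 bH) // eqn_leq => -> ->.
Qed.

End BadStructure.

(** * Blocked requests in a component *)

Section Component.
Variables (G : sgraph) (m : nat) (S K : {set G}).
Implicit Types (A B C D H T : {set G}) (q t u v w y z : G).

Notation x := (dgin S).
(** For [A] disjoint from [S], the number of edges between the two. *)
Definition ext A : nat := \sum_(v in A) dgin S v.

Record blocked t H : Prop := Blocked {
  blocked_conn : conn H;
  blocked_closed : closed_in H (K :\ t);
  blocked_nbr : exists2 v, v \in H & adj t v;
  blocked_deg : forall v, v \in H -> #|nbr v| = m;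
  blocked_noncut : forall v, v \in H -> conn (H :\ v) -> 0 < dgin S v + adj v t;
  blocked_side : forall z A, z \in H -> closed_in A (H :\ z) -> A != set0 ->
    m <= (ext A + dgin A t).+1;
  blocked_regular : (forall v, v \in H -> conn (H :\ v)) ->
    {in H &, forall u v, dgin H u = dgin H v};
  blocked_ext : 0 < ext H }.

Hypotheses (m3 : 3 <= m) (cK : conn K) (KS : [disjoint K & S])
  (nK : forall v, v \in K -> nbr v \subset K :|: S).

Lemma degE v : v \in K -> #|nbr v| = dgin K v + x v.
Proof.
move=> vK; rewrite -(setIidPl (nK vK)) setIUr cardsU.
suff -> : nbr v :&: K :&: (nbr v :&: S) = set0 by rewrite cards0 subn0.
apply/setP => u; rewrite !inE; apply/negbTE/negP => /andP[/andP[_ uK] /andP[_ uS]].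
by have := disjointFr KS uK; rewrite uS.
Qed.

Lemma ext_sub A B : A \subset B -> ext A <= ext B.
Proof.
by move=> sAB; rewrite [leqRHS](big_setID A) /= (setIidPr sAB) leq_addr.
Qed.

Lemma ext_split A B : A \subset B -> ext B = ext A + ext (B :\: A).
Proof. by move=> sAB; rewrite /ext (big_setID A) /= (setIidPr sAB). Qed.

(** No vertex of [D] is adjacent to [z], so one without neighbours in [S] is a cut vertex of [H].
    Its side away from [w] lies in [D], hence is a side in [K] too. *)
Lemma nice_blocked z H w D : blocked z H -> z \in K -> w \in H ->
  closed_in D (K :\ w) -> D != set0 -> D \subset H -> z \notin D -> nice K set0 x w D.
Proof.
move=> bH zK wH cD nD sDH zD; have cH := blocked_closed bH.
have zH := side_notin cH; have sHK := side_sub cH.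
have wz : z != w by apply: contraNneq zH => ->.
have zKw : z \in K :\ w by rewrite !inE wz.
have nDz u : u \in D -> ~~ adj u z by move=> uD; apply: closed_nadj cD uD zKw zD.
apply/and3P; split=> //; apply/forall_inP => v; rewrite setD0 => vD.
have vH := subsetP sDH v vD; have vK := subsetP sHK v vH.
rewrite -degE // (blocked_deg bH) // m3 /= lt0n; have [xv /=|//] := eqVneq (x v) 0.
have ncv : ~~ conn (H :\ v).
  apply/negP => /(blocked_noncut bH vH).
  by rewrite xv (negPf (nDz v vD)).
have vw : w != v by apply: contraTneq vD => <-; apply: side_notin cD.
have [B [cB nB _ wB]] := cut_side w ncv.
have sBD : B \subset D.
  apply/subsetP => u uB; apply/negPn/negP => uD.
  have cDH : closed_in D (H :\ w).
    apply: (closed_sub cD) (setSD _ sHK); apply/subsetP => y yD; rewrite !inE (subsetP sDH) // andbT.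
    by apply: contraTneq yD => ->; apply: side_notin cD.
  have uHD : u \in H :\: D by rewrite inE uD (subsetP (side_sub cB)).
  have sHD : H :\: D \subset H :\ v.
    by apply/subsetP => y; rewrite !inE => /andP[yD ->]; rewrite andbT; apply: contraNneq yD => ->.
  have /subsetP/(_ w) := conn_sub cB (conn_del (blocked_conn bH) wH cDH) sHD uB uHD.
  by rewrite inE wH (side_notin cD) (negPf wB) => /(_ isT).
apply: (@not_conn _ B) => //; last first.
  by apply/set0Pn; exists w; rewrite !inE wB vw (subsetP sHK).
have sBH := side_sub cB.
apply/closedP; split.
  by apply: subset_trans (proj1 (closedP _ _ cB)) (setSD _ sHK).
move=> u y uB; rewrite !inE => /andP[yv yK] uy.
apply: (proj2 (closedP _ _ cB) u) => //; rewrite !inE yv /=.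
apply: (proj2 (closedP _ _ cH) u) => //; first exact: (subsetP sBH).
rewrite !inE yK andbT; apply: contraTneq uy => ->; exact/nDz/(subsetP sBD).
Qed.

(** * Requests [q] blocked by all of [K :\ q] *)

Section Crossing.
Variable Q : {set G}.
Hypotheses (Q2 : 1 < #|Q|) (sQK : Q \subset K) (xQ : forall q, q \in Q -> x q = 0)
  (bQ : forall q, q \in Q -> blocked q (K :\ q)).

Lemma crossing_deg v : v \in K -> #|nbr v| = m.
Proof.
move=> vK; have /card_gt0P[q] : 0 < #|Q :\ v| by move: Q2; rewrite (cardsD1 v); case: (v \in Q); clear; lia.
by move=> /setD1P[qv qQ]; apply: (blocked_deg (bQ qQ)); rewrite !inE eq_sym qv.
Qed.

Lemma crossing_ext : 0 < ext K.
Proof.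
have /card_gt0P[q qQ] := ltnW Q2.
exact: leq_trans (blocked_ext (bQ qQ)) (ext_sub (subsetDl _ _)).
Qed.

Lemma crossing_cut q v : q \in Q -> v \in K -> v != q -> x v = 0 -> ~~ adj v q ->
  ~~ conn ((K :\ q) :\ v).
Proof.
move=> qQ vK vq xv vnq; apply/negP => cc.
have := blocked_noncut (bQ qQ) _ cc; rewrite xv (negPf vnq) !inE vq vK.
by move=> /(_ isT).
Qed.

Lemma setD1C (A : {set G}) u v : (A :\ u) :\ v = (A :\ v) :\ u.
Proof. by rewrite !setDDl setUC. Qed.

(** Vertices of [C] without neighbours in [S] are not adjacent to [w], so they cut [K :\ w] and even
    [C] together with [q] and [z]. [nice_count] with root [q] then applies there. *)
Lemma crossing_side_count q z w C : q \in Q -> z \in Q -> q != z -> w \in Q -> w != q -> w != z ->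
    closed_in C ((K :\ q) :\ z) -> w \notin C ->
  #|[set v in C | x v == 0]| <= 3 * ext C.
Proof.
move=> qQ zQ qz wQ wq wz cC wC.
have qK := subsetP sQK q qQ; have zK := subsetP sQK z zQ; have wK := subsetP sQK w wQ.
have sC : C \subset (K :\ q) :\ z by case/closedP: cC.
have CP v : v \in C -> [/\ v \in K, v != q & v != z].
  by move/(subsetP sC); rewrite !inE => /and3P[-> -> ->].
set Z := [set v in C | x v == 0].
have [->|nZ] := eqVneq Z set0; first by rewrite cards0.
have nC : C != set0.
  by case/set0Pn: nZ => v; rewrite inE => /andP[vC _]; apply/set0Pn; exists v.
have cCs : closed_in C ((K :\ z) :\ q) by rewrite setD1C.
set A := (z |: C) :|: (q |: C).
have qA : q \in A by rewrite !inE eqxx orbT.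
have zA : z \in A by rewrite !inE eqxx.
have CA v : v \in C -> v \in A by move=> vC; rewrite !inE vC orbT.
have AE v : v \in A = [|| v == q, v == z | v \in C].
  by rewrite !inE; do ![case: (_ == _) => //=]; rewrite ?orbT //; case: (v \in C).
have cA : conn A.
  have [v vC] := set0Pn _ nC; apply: (@conn_U _ _ _ v); rewrite ?inE ?vC ?orbT //.
    by apply: (@conn_addS _ (K :\ q)) cC; rewrite ?inE 1?eq_sym ?qz //; exact: blocked_conn (bQ qQ).
  by apply: (@conn_addS _ (K :\ z)) cCs; rewrite ?inE ?qz //; exact: blocked_conn (bQ zQ).
have sAK : A \subset K.
  by apply/subsetP => v; rewrite AE => /or3P[/eqP ->|/eqP ->|/CP[]].
have nadjC u v : u \in C -> v \in K -> v \notin A -> ~~ adj u v.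
  move=> uC vK; rewrite AE !negb_or => /and3P[vq vz vC].
  by apply: closed_nadj cC uC _ vC; rewrite !inE vq vz.
have dC v : v \in C -> dgin A v + x v = m.
  move=> vC; have [vK _ _] := CP v vC; rewrite -(crossing_deg vK) degE //; congr (_ + _).
  by apply: dgin_eq => // u uK; apply: contraTT; apply: nadjC.
have wA : w \notin A by rewrite AE !negb_or wq wz.
have cutC v : v \in C -> x v = 0 -> ~~ conn (A :\ v).
  move=> vC xv; have [vK vq vz] := CP v vC.
  have vw : v != w by apply: contraNneq wC => <-.
  have := crossing_cut wQ vK vw xv (nadjC _ _ vC wK wA); apply: contra => cAv.
  apply/connP => B cB nB; apply/eqP; rewrite eqEsubset (proj1 (closedP _ _ cB)) /=.
  have sAv : A :\ v \subset (K :\ w) :\ v.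
    apply: setSD; apply/subsetP => u uA; rewrite !inE (subsetP sAK) // andbT.
    by apply: contraTneq uA => ->.
  have qAv : q \in A :\ v by rewrite !inE eq_sym vq eqxx orbT.
  have cKw := blocked_conn (bQ wQ).
  (* Missing [q], the set [B'] misses the connected set [A :\ v], so [v] has no neighbour in it. It
     is then closed in the connected set [K :\ w]. *)
  have main B' : closed_in B' ((K :\ w) :\ v) -> q \notin B' -> B' = set0.
    move=> cB' qB'; apply/eqP/negPn/negP => nB'.
    have disj u : u \in B' -> u \notin A.
      move=> uB'; apply: contra qB' => uA; apply: (subsetP (conn_sub cB' cAv sAv uB' _)) => //.
      rewrite !inE in uA *; rewrite uA andbT.
      by apply: contraTneq uB' => ->; apply: side_notin cB'.
    have /closedP[sB' cB''] := cB'.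
    suff eB : B' = K :\ w by move: qB'; rewrite eB !inE eq_sym wq qK.
    apply: (connP _ cKw) => //; apply/closedP; split; first exact: subset_trans sB' (subsetDl _ _).
    move=> u y uB' yK uy; apply: (cB'' u) => //; rewrite in_setD1 yK andbT.
    apply: contraTneq uy => ->; rewrite adj_sym; apply: nadjC (disj _ uB') => //.
    by have := subsetP sB' u uB'; rewrite !inE => /and3P[].
  have [qB|qB] := boolP (q \in B).
    by rewrite -setD_eq0; apply/eqP/main; [exact: closedD|rewrite inE qB].
  by case/eqP: nB; apply: main.
have eA : \sum_(v in A :\: [set q]) x v = ext C.
  rewrite (bigD1 z) /=; last by rewrite !inE eq_sym qz eqxx.
  rewrite xQ // add0n; apply: eq_bigl => v; rewrite in_setD AE in_set1.
  case: (boolP (v \in C)) => [/CP[_ -> ->]|_]; first by rewrite !orbT.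
  by case: (eqVneq v q) => //=; case: (eqVneq v z).
have q1 : [set q] != set0 by apply/set0Pn; exists q; rewrite set11.
have : #|Z| + (1 < dgin A q) <= (ext C).*2.+1.
  rewrite -eA -slack1; apply: nice_count => //.
  - by right; exists q.
  - apply/subsetP => v; rewrite !inE => /andP[vC _]; have [_ -> _] := CP v vC.
    by rewrite vC !orbT.
  - move=> v; rewrite inE => /andP[vC /eqP xv]; split=> //.
      by have := dC v vC; rewrite xv addn0 => ->.
    have [E [cE nE _ zE]] := cut_side z (cutC v vC xv).
    exists E; apply/and3P; split=> //; apply/forall_inP => u; rewrite !inE => /andP[uq uE].
    have uC : u \in C.
      have := subsetP (side_sub cE) u uE; rewrite AE (negPf uq) /=.
      by case: eqVneq uE zE => // -> ->.
    rewrite dC // m3 /= lt0n; case: eqVneq => //= xu; exact: cutC.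
(* If [q] has two neighbours in [A], the slack cancels the extra 1; otherwise the side bound makes
   [ext C] at least [m - 2], hence positive. *)
have := blocked_side (bQ qQ) _ cC nC; rewrite !inE eq_sym qz zK => /(_ isT).
have : dgin C q <= dgin A q by apply: dginS; apply/subsetP.
have : 0 < #|Z| by rewrite card_gt0.
by move: m3; clear; case: (ltnP 1 (dgin A q)) => /=; lia.
Qed.

Definition separated : bool :=
  [exists q in Q, exists z in Q :\ q, exists C : {set G}, closed_in C ((K :\ q) :\ z) &&
     (Q :&: C != set0) && (Q :&: (((K :\ q) :\ z) :\: C) != set0)].

(** Each part obeys the bound with factor 3 and holds a member of [Q], so it sends an edge to [S];
    these edges pay for [q] and [z]. *)
Lemma separated_count : separated -> #|[set v in K | x v == 0]| <= 4 * ext K.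
Proof.
case/exists_inP=> q qQ /exists_inP[z /setD1P[zq zQ] /existsP[C /andP[/andP[cC]]]].
case/set0Pn=> u /setIP[uQ uC] /set0Pn[w /setIP[wQ wC']].
have qK := subsetP sQK q qQ; have zK := subsetP sQK z zQ.
set U := (K :\ q) :\ z in cC wC'.
have sCU : C \subset U by case/closedP: cC.
have [wU wC] : w \in U /\ w \notin C by case/setDP: wC'.
have [wq wz] : w != q /\ w != z by move: wU; rewrite !inE => /and3P[].
have [uq uz] : u != q /\ u != z by move: (subsetP sCU u uC); rewrite !inE => /and3P[].
have qz : q != z by rewrite eq_sym.
have cnt1 := crossing_side_count qQ zQ qz wQ wq wz cC wC.
have uC' : u \notin U :\: C by rewrite inE uC.
have cnt2 := crossing_side_count qQ zQ qz uQ uq uz (closedD cC) uC'.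
have ext1 B v : v \in B -> v \in Q -> #|[set y in B | x y == 0]| <= 3 * ext B -> 0 < ext B.
  move=> vB vQ le; have : 0 < #|[set y in B | x y == 0]|.
    by apply/card_gt0P; exists v; rewrite inE vB xQ.
  by move=> lt; have := leq_trans lt le; case: (ext B).
have e1 := ext1 _ _ uC uQ cnt1; have e2 := ext1 _ _ wC' wQ cnt2.
have eU : ext C + ext (U :\: C) <= ext K.
  by rewrite -ext_split //; apply: ext_sub; rewrite /U !setDDl subsetDl.
have : #|[set v in K | x v == 0]| <=
    #|[set q; z] :|: ([set v in C | x v == 0] :|: [set v in U :\: C | x v == 0])|.
  apply: subset_leq_card; apply/subsetP => v; rewrite !inE => /andP[vK ->]; rewrite vK !andbT.
  by case: (v == q); case: (v == z); case: (v \in C).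
move: (leq_card_setU [set q; z] ([set v in C | x v == 0] :|: [set v in U :\: C | x v == 0])).1.
move: (leq_card_setU [set v in C | x v == 0] [set v in U :\: C | x v == 0]).1.
rewrite cards2; move: cnt1 cnt2 e1 e2 eU (leq_b1 (q != z)); clear; lia.
Qed.

(* Each other member of [Q] is a neighbour of [q], or, with [q], cuts off a part of [K] free of [Q]
   that contains a private neighbour of [q]. *)
Lemma unseparated_card : ~~ separated -> #|Q| <= m.+1.
Proof.
move=> ns; have /card_gt0P[q qQ] := ltnW Q2.
have qK := subsetP sQK q qQ; have cKq := blocked_conn (bQ qQ).
pose priv q' D := [&& conn D, closed_in D ((K :\ q) :\ q') & Q :&: D == set0].
(* A [q'] adjacent to [q] can represent itself; any other needs a [y] in a part cut off by [q] and
   [q'] and free of [Q]. *)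
pose good q' y := adj q y && ((y == q') || (y \notin Q) && [exists D : {set G}, priv q' D && (y \in D)]).
have exg q' : q' \in Q :\ q -> exists y, good q' y.
  move=> /setD1P[q'q q'Q]; have q'K := subsetP sQK q' q'Q.
  have [a|na] := boolP (adj q q'); first by exists q'; rewrite /good a eqxx.
  have cut : ~~ conn ((K :\ q) :\ q').
    by apply: crossing_cut => //; [apply: xQ|rewrite adj_sym].
  have [A [cA nA nC _]] := cut_side q cut.
  have [B [cB nB BQ]] : exists B, [/\ closed_in B ((K :\ q) :\ q'), B != set0 & Q :&: B == set0].
    have [QA|QA] := boolP (Q :&: A == set0); first by exists A.
    exists (((K :\ q) :\ q') :\: A); split=> //; first exact: closedD.
    apply: contraNT ns => QC; apply/exists_inP; exists q => //.
    by apply/exists_inP; exists q'; rewrite ?inE ?q'q //; apply/existsP; exists A; rewrite cA QA.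
  have [D [sDB cD cnD nD]] := closed_conn cB nB.
  have QD : Q :&: D == set0.
    by rewrite -subset0; apply: subset_trans (setIS _ sDB) _; rewrite subset0.
  have [y yD qy] : exists2 y, y \in D & adj q y.
    apply: (@conn_nbr _ (K :\ q')); [exact: blocked_conn (bQ q'Q)| |by rewrite setD1C|by []].
    by rewrite !inE eq_sym q'q.
  exists y; rewrite /good qy; apply/orP; right; apply/andP; split.
    by apply/negP => yQ; move/eqP/setP/(_ y): QD; rewrite !inE yQ yD.
  by apply/existsP; exists D; rewrite /priv cnD cD QD yD.
pose f q' := odflt q [pick y | good q' y].
have fg q' : q' \in Q :\ q -> good q' (f q').
  by move=> q'Q; rewrite /f; case: pickP => //= h; have [y] := exg q' q'Q; rewrite h.
have notQ D v : Q :&: D == set0 -> v \in Q -> v \notin D.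
  by move=> /eqP/setP/(_ v); rewrite !inE => + vQ; rewrite vQ /= => ->.
have finj : {in Q :\ q &, injective f}.
  move=> q1 q2 q1Q q2Q e12; have := fg _ q1Q; have := fg _ q2Q; rewrite -e12 /good.
  have [_ q1Q'] := setD1P q1Q; have [q2q q2Q'] := setD1P q2Q.
  case/andP=> _ /orP[/eqP e2|/andP[nQ /existsP[D2 /andP[/and3P[_ cD2 QD2] yD2]]]].
    by case/andP=> _ /orP[/eqP e1|/andP[]]; [rewrite -e1 e2|rewrite e2 q2Q'].
  case/andP=> _ /orP[/eqP e1|/andP[_ /existsP[D1 /andP[/and3P[cnD1 cD1 QD1] yD1]]]].
    by rewrite e1 q1Q' in nQ.
  apply/eqP/contraT => n12; have q1q : q1 != q by case/setD1P: q1Q.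
  have q1K := subsetP sQK _ q1Q'.
  have sD1 : D1 \subset (K :\ q) :\ q2.
    apply/subsetP => v vD1; have := subsetP (proj1 (closedP _ _ cD1)) v vD1.
    rewrite !inE => /and3P[_ -> ->]; rewrite !andbT.
    by apply: contraTneq vD1 => ->; apply: notQ QD1 _.
  (* A shared [y] puts [D1] inside [D2]. As [q1] has a neighbour in [D1], it would lie in [D2],
     which is free of [Q]. *)
  have sD12 := conn_sub cD2 cnD1 sD1 yD2 yD1.
  have nD1 : D1 != set0 by apply/set0Pn; exists (f q1).
  have q1Kq : q1 \in K :\ q by rewrite !inE q1q.
  have [v vD1 q1v] := conn_nbr cKq q1Kq cD1 nD1.
  have := notQ _ _ QD2 q1Q'; rewrite (proj2 (closedP _ _ cD2) v) //.
  - exact: (subsetP sD12).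
  - by rewrite !inE n12 q1q.
  - by rewrite adj_sym.
rewrite (cardsD1 q) qQ add1n ltnS -(crossing_deg qK) -(card_in_imset finj).
by apply/subset_leq_card/subsetP => y /imsetP[q' /fg/andP[qy _] ->]; rewrite inE.
Qed.

(** Add the side bounds of both parts of the cut; together they use at most [m] edges at [q]. *)
Lemma crossing_ext_cut q v : q \in Q -> v \in K :\ q -> ~~ conn ((K :\ q) :\ v) ->
  m <= (ext K).+2.
Proof.
move=> qQ vK /(cut_side q)[A [cA nA nC _]].
have l1 := blocked_side (bQ qQ) vK cA nA.
have l2 := blocked_side (bQ qQ) vK (closedD cA) nC.
set U := (K :\ q) :\ v in cA l2.
have sAU : A \subset U by case/closedP: cA.
have sUK : U \subset K by rewrite /U !setDDl subsetDl.
have e1 : ext A + ext (U :\: A) <= ext K by rewrite -ext_split // ext_sub.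
have e2 : dgin A q + dgin (U :\: A) q <= m.
  rewrite -(dgin_split _ sAU) -(crossing_deg (subsetP sQK _ qQ)).
  exact/subset_leq_card/subsetIl.
by move: l1 l2 e1 e2; clear; lia.
Qed.

(* Without cut vertices every [K :\ q] is [m.-1]-regular, so that each vertex of [K] other than [q]
   is adjacent either to [q] or, by a single edge, to [S]. *)
Lemma crossing_regular_card :
  (forall q v, q \in Q -> v \in K :\ q -> conn ((K :\ q) :\ v)) -> #|Q| <= (ext K).+1.
Proof.
move=> nc.
have degK v : v \in K -> dgin K v + x v = m by move=> vK; rewrite -degE // crossing_deg.
(* Another member [z] of [Q] has no neighbour in [S], so it is adjacent to [q] and has degree
   [m - 1] in [K :\ q]. Regularity carries this degree over to [v]. *)
have one q v : q \in Q -> v \in K -> v != q -> x v + adj v q = 1.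
  move=> qQ vK vq; have qK := subsetP sQK q qQ.
  have /card_gt0P[z /setD1P[zq zQ]] : 0 < #|Q :\ q| by move: Q2; rewrite (cardsD1 q) qQ; clear; lia.
  have zK := subsetP sQK z zQ.
  have zKq : z \in K :\ q by rewrite !inE zq.
  have vKq : v \in K :\ q by rewrite !inE vq.
  have := blocked_regular (bQ qQ) (nc q ^~ qQ) vKq zKq.
  have := blocked_noncut (bQ qQ) zKq (nc q z qQ zKq).
  have := degK z zK; have := degK v vK; rewrite !(dgin_D1 _ qK) (xQ zQ).
  by case: (adj z q) => //; move: m3; clear; lia.
have [y yK xy] : exists2 y, y \in K & 0 < x y.
  have [/exists_inP//|] := boolP [exists y in K, 0 < x y].
  rewrite negb_exists_in => /forall_inP h; have := crossing_ext.
  by rewrite /ext big1 // => v /h; rewrite -eqn0Ngt => /eqP.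
have yQ : y \notin Q by apply: contraL xy => /xQ ->.
have /card_gt0P[q qQ] := ltnW Q2; have qK := subsetP sQK q qQ.
pose Y := [set v in K | 0 < x v].
have leY : #|Y| <= ext K.
  apply: leq_trans (ext_sub (A := Y) _); last by apply/subsetP => v; rewrite inE => /andP[].
  by apply: sum_pos_card => v; rewrite inE => /andP[].
have cardK : #|K| <= m.+1 + #|Y|.
  have sK : K \subset q |: (nbr q :&: K) :|: Y.
    apply/subsetP => v vK; rewrite !inE vK !andbT.
    have [->//|vq] := eqVneq v q; have := one q v qQ vK vq.
    by rewrite adj_sym; case: (adj q v) => //=; rewrite addn0 => ->.
  apply: leq_trans (subset_leq_card sK) _; apply: leq_trans (leq_card_setU _ _) _.
  rewrite leq_add2r cardsU1; have := degK q qK; rewrite (xQ qQ) /dgin.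
  by case: (q \notin _) => /=; move: #|_ :&: _|; clear; lia.
(* Having a neighbour in [S], [y] is adjacent to no member of [Q]. *)
have dy : dgin K y <= #|K :\: (y |: Q)|.
  apply: subset_leq_card; apply/subsetP => v; rewrite !inE => /andP[yv vK].
  rewrite vK andbT negb_or eq_sym adj_neq //=; apply/negP => vQ.
  have yv' : y != v by rewrite adj_neq.
  by have := one v y vQ yK yv'; rewrite yv; move: xy; clear; lia.
have xy1 : x y = 1.
  have yq : y != q by apply: contraNneq yQ => ->.
  by have := one q y qQ yK yq; move: xy; case: (adj y q); clear; lia.
have : #|K| = #|y |: Q| + #|K :\: (y |: Q)|.
  rewrite -(cardsID (y |: Q) K) (setIidPr _) //.
  by rewrite subUset sub1set yK.
rewrite cardsU1 yQ; have := degK y yK; rewrite xy1.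
by move: leY cardK dy; clear; lia.
Qed.

Lemma unseparated_card_ext : ~~ separated -> #|Q| <= (ext K).+3.
Proof.
move=> ns; have [/exists_inP[q qQ /exists_inP[v vK ncv]]|nex] :=
  boolP [exists q in Q, exists v in K :\ q, ~~ conn ((K :\ q) :\ v)].
  apply: leq_trans (unseparated_card ns) _.
  by rewrite ltnS (crossing_ext_cut qQ vK ncv).
apply: leq_trans (crossing_regular_card _) _; last by rewrite ltnW.
move=> q v qQ vK; apply: contraNT nex => ncv; apply/exists_inP; exists q => //.
by apply/exists_inP; exists v.
Qed.

End Crossing.

(** * Combining nice and non-nice requests of a component *)

Section Requests.
Variables (T : {set G}) (Hs : G -> {set G}).
Hypotheses (sTK : T \subset K) (xT : forall t, t \in T -> x t = 0)
  (bT : forall t, t \in T -> blocked t (Hs t)).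

Definition nice_requests := [set t in T | [exists D : {set G}, nice K set0 x t D]].

Lemma nice_requests_card : nice_requests != set0 -> #|nice_requests| + 2 <= 2 * ext K.
Proof.
move=> nZ; have := @nice_count _ K set0 x nice_requests cK (or_introl erefl).
rewrite setD0 /slack eqxx => h.
suff : #|nice_requests| + 3 <= (ext K).*2.+1 by clear; lia.
apply: h => //; first by apply/subsetP => t; rewrite inE => /andP[/(subsetP sTK)].
move=> t; rewrite inE => /andP[tT /existsP[D nD]].
by split; [exact: xT|rewrite ?eqxx|exists D].
Qed.

Lemma blocked_pair z w : z \in T :\: nice_requests -> w \in T :\: nice_requests -> z != w ->
  [/\ Hs z = K :\ z, Hs w = K :\ w & w \in Hs z] \/ [disjoint Hs z & Hs w].
Proof.
have nn t : t \in T :\: nice_requests -> t \in T /\ forall D, ~~ nice K set0 x t D.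
  case/setDP=> tT; rewrite inE tT /= => /existsPn h; by split.
move=> /nn[zT nz] /nn[wT nw] zw; have zK := subsetP sTK z zT; have wK := subsetP sTK w wT.
have bz := bT zT; have bw := bT wT.
(* If [a] were outside [Hs b], then [Hs b] would lie inside [Hs a] and be a nice side of [b]. *)
have nest a b : a \in T -> b \in T -> a != b -> (forall D, ~~ nice K set0 x b D) ->
    b \in Hs a -> a \in Hs b.
  move=> aT bT' ab nb bHa; apply: contraT => aHb; have ba := bT aT; have bb := bT bT'.
  have cHa := blocked_closed ba; have cHb := blocked_closed bb.
  have [v vHb bv] := blocked_nbr bb.
  have vHa : v \in Hs a.
    apply: (proj2 (closedP _ _ cHa) b) => //; rewrite !inE (subsetP (side_sub cHb)) // andbT.
    by apply: contraNneq aHb => <-.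
  have sHb : Hs b \subset K :\ a.
    apply/subsetP => u uHb; rewrite !inE (subsetP (side_sub cHb)) // andbT.
    by apply: contraNneq aHb => <-.
  have sHba := conn_sub cHa (blocked_conn bb) sHb vHa vHb.
  have nHb : Hs b != set0 by apply/set0Pn; exists v.
  by have := nb (Hs b); rewrite (nice_blocked ba (subsetP sTK _ aT) bHa cHb nHb sHba aHb).
(* Any other sides of [a] would lie in [Hs b] and avoid [b], hence be nice. *)
have full a b : a \in T -> b \in T -> a != b -> (forall D, ~~ nice K set0 x a D) ->
    b \in Hs a -> a \in Hs b -> Hs a = K :\ a.
  move=> aT bT' ab na bHa aHb; have ba := bT aT; have bb := bT bT'.
  have aK := subsetP sTK _ aT; have bK := subsetP sTK _ bT'.
  have cHa := blocked_closed ba; have cHb := blocked_closed bb.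
  set D := (K :\ a) :\: Hs a; have cD : closed_in D (K :\ a) := closedD cHa.
  apply/eqP; rewrite eqEsubset (proj1 (closedP _ _ cHa)) -setD_eq0 -/D.
  apply: contraT => nD.
  have bD : b \notin D by rewrite inE bHa.
  have ba' : b != a by rewrite eq_sym.
  have sD : a |: D \subset Hs b.
    exact: (side_root_sub cK aK cD bK ba' bD cHb (setU11 _ _) aHb).
  have sDb : D \subset Hs b by apply: subset_trans (subsetUr _ _) sD.
  by have := na D; rewrite (nice_blocked bb bK aHb cD nD sDb bD).
have wz : w != z by rewrite eq_sym.
have [wHz|wHz] := boolP (w \in Hs z).
  have zHw := nest z w zT wT zw nw wHz; left; split=> //.
    exact: (full z w).
  exact: (full w z).
have zHw : z \notin Hs w by apply: contra wHz; apply: nest.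
(* Meeting sets would contain each other, and a neighbour of [z] in [Hs w] would bring [z] into
   [Hs w]. *)
right; apply/pred0P => u /=; apply/negbTE/negP => /andP[uz uw].
have cHz := blocked_closed bz; have cHw := blocked_closed bw.
have sub a b : a \notin Hs b -> closed_in (Hs b) (K :\ b) -> Hs b \subset K :\ a.
  move=> aHb cHb; apply/subsetP => v vHb; rewrite !inE (subsetP (side_sub cHb)) // andbT.
  by apply: contraNneq aHb => <-.
have s1 := conn_sub cHz (blocked_conn bw) (sub _ _ zHw cHw) uz uw.
have s2 := conn_sub cHw (blocked_conn bz) (sub _ _ wHz cHz) uw uz.
have [v vHz zv] := blocked_nbr bz.
case/negP: zHw; apply: (proj2 (closedP _ _ cHw) v); last by rewrite adj_sym.
  exact: (subsetP s2).
by rewrite !inE zw.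
Qed.

Lemma disjoint_card T' : (forall t, t \in T' -> Hs t \subset K /\ 0 < ext (Hs t)) ->
    {in T' &, forall z w, z != w -> [disjoint Hs z & Hs w]} -> #|T'| <= ext K.
Proof.
move=> hT dj; have tI : trivIset (Hs @: T').
  apply/trivIsetP => A B /imsetP[z zT ->] /imsetP[w wT ->] n; apply: dj => //.
  by apply: contraNneq n => ->.
have inj : {in T' &, injective Hs}.
  move=> z w zT wT e; apply/eqP/contraT => /(dj _ _ zT wT); rewrite -e -setI_eq0 setIid => /eqP e0.
  by have [_] := hT z zT; rewrite e0 /ext big_set0.
have sub : cover (Hs @: T') \subset K.
  by apply/bigcupsP => A /imsetP[z zT ->]; case: (hT z zT).
apply: leq_trans (ext_sub sub); rewrite /ext big_trivIset //= big_imset //=.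
by rewrite -sum1_card; apply: leq_sum => t /hT[].
Qed.

Lemma blocked_requests_card : #|T| <= 4 * ext K.
Proof.
set Q := T :\: nice_requests.
have sN : nice_requests \subset T by apply/subsetP => t; rewrite inE => /andP[].
have cT : #|T| = #|nice_requests| + #|Q|.
  by rewrite -(cardsID nice_requests T) (setIidPr sN).
have cN := nice_requests_card.
have QT t : t \in Q -> t \in T by case/setDP.
have [/exists_inP[z zQ /exists_inP[w wQ /andP[zw ndj]]]|ndj] :=
    boolP [exists z in Q, exists w in Q, (z != w) && ~~ [disjoint Hs z & Hs w]]; last first.
  have cQ : #|Q| <= ext K.
    apply: disjoint_card => [t /QT tT|u v uQ vQ uv].
      by split; [exact: side_sub (blocked_closed (bT tT))|exact: blocked_ext (bT tT)].
    apply: contraNT ndj => n; apply/exists_inP; exists u => //.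
    by apply/exists_inP; exists v; rewrite ?uv.
  have [N0|/cN] := eqVneq nice_requests set0; first by move: cT; rewrite N0 cards0; move: cQ; clear; lia.
  by move: cT cQ; clear; lia.
have [[ez ew wz]|d] := blocked_pair zQ wQ zw; last by rewrite d in ndj.
have bQ q : q \in Q -> blocked q (K :\ q).
  move=> qQ; suff <- : Hs q = K :\ q by apply: bT (QT _ qQ).
  have [->//|qz] := eqVneq q z.
  (* Disjoint from [K :\ z], the set [Hs q] could only be [z] alone, which sends no edge to [S]. *)
  have [[]//|] := blocked_pair qQ zQ qz; rewrite ez => dj.
  have [v vq qv] := blocked_nbr (bT (QT q qQ)).
  have sH := side_sub (blocked_closed (bT (QT q qQ))).
  have qK := subsetP sTK _ (QT q qQ).
  have Hz u : u \in Hs q -> u = z.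
    move=> uH; have := disjointFr dj uH; rewrite !inE (subsetP sH) // andbT.
    by move/negbFE/eqP.
  have e1 := Hz v vq; subst v.
  have e2 : ext (Hs q) <= x z.
    rewrite -(big_set1 (addn) z x) /ext; apply: ext_sub.
    by apply/subsetP => u /Hz ->; rewrite set11.
  by have := leq_trans (blocked_ext (bT (QT q qQ))) e2; rewrite xT ?QT.
have Q2 : 1 < #|Q|.
  have : [set z; w] \subset Q by apply/subsetP => u; rewrite in_set2 => /orP[] /eqP ->.
  by move/subset_leq_card; rewrite cards2 zw.
have sQK : Q \subset K by apply/subsetP => q /QT /(subsetP sTK).
have xQ q : q \in Q -> x q = 0 by move/QT/xT.
have e0 := crossing_ext Q2 bQ.
have [sep|ns] := boolP (separated Q).
  apply: leq_trans (separated_count Q2 sQK xQ bQ sep); apply: subset_leq_card.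
  by apply/subsetP => t tT; rewrite inE (subsetP sTK) ?xT.
(* With [e = ext K] positive, the at most [e + 3] members of [Q] and either no nice request or at
   most [2 * e - 2] of them make at most [4 * e]. *)
have cQ := unseparated_card_ext Q2 sQK xQ bQ ns.
have [N0|/cN] := eqVneq nice_requests set0; first by move: cT; rewrite N0 cards0; move: cQ e0; clear; lia.
by move: cT cQ e0; clear; lia.
Qed.

End Requests.
End Component.

(** * Finite lists *)

Lemma complete_iso (G : sgraph) n :
  (forall u v : G, u != v -> adj u v) -> #|G| = n -> graph_iso G (complete_graph n).
Proof.
move=> cG eG; exists (fun v => cast_ord eG (enum_rank v)).
  apply: (bij_comp (f := cast_ord eG)); last exact: enum_rank_bij.
  by exists (cast_ord (esym eG)); [exact: cast_ordK|exact: cast_ordKV].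
move=> u v; have -> (i j : complete_graph n) : adj i j = (i != j) by [].
rewrite (inj_eq (@cast_ord_inj _ _ _)) (inj_eq enum_rank_inj).
by case: (eqVneq u v) => [->|/cG ->]; rewrite ?adj_irrefl.
Qed.

Lemma connected_conn (G : sgraph) : connected_graph G -> conn [set: G].
Proof.
move=> [_ cG]; apply/connP => A /closedP[_ cA] /set0Pn[u uA]; apply/setP => v.
rewrite inE; have /closed_connect/(_ _ _ (cG u v)) <- // : fingraph.closed (@adj G) (mem A).
by move=> x y xy; apply/idP/idP => xA; [apply: (cA x)|apply: (cA y)]; rewrite ?inE // adj_sym.
Qed.

Section FiniteLists.
Variables (G : sgraph) (D : finType) (d0 : D) (L : G -> {set D}).
Implicit Types (A B H K S U : {set G}) (t u v w z : G).

Notation m := (max_degree G).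

Hypotheses (hconn : connected_graph G) (m3 : 3 <= m)
  (hK : ~ graph_iso G (complete_graph m.+1))
  (dL : forall v, deg v <= #|L v|) (dL_lt : forall v, deg v < m -> deg v < #|L v|).

Lemma deg_le v : deg v <= m.
Proof. exact: leq_bigmax. Qed.

Definition residual U (f : G -> D) : G -> {set D} := fun v => L v :\: f @: (nbr v :&: U).

(** Take a minimal uncolourable closed set. A list loses at most [dgin U v] colours, so tightness
    gives [#|L v| <= deg v], impossible below degree [m]. *)
Lemma uncolorable_bad U f : ~~ colorable (~: U) (residual U f) ->
  exists2 H, closed_in H (~: U) & bad H (residual U f) /\ {in H, forall v, deg v = m}.
Proof.
move=> nc; have cU : closed_in (~: U) (~: U) by apply/closedP.
have [||H [_ cH cnH ncH]] := @min_conn G (fun A => ~~ colorable A (residual U f)) _ _ _ _ cU nc.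
- move=> B E ncB cE; apply/orP; rewrite -negb_and; apply: contra ncB => /andP[].
  exact: colorable_split.
- by rewrite negbK; apply/colorableP; exists (fun=> d0) => [v|u v]; rewrite inE.
exists H => //.
have dE v : v \in H -> deg v = dgin H v + dgin U v.
  move=> vH; have -> : dgin H v = dgin (~: U) v.
    apply: dgin_eq; first by case/closedP: cH.
    by move=> u; apply: (proj2 (closedP _ _ cH)).
  by rewrite /deg -/(nbr v) -(cardsID U) addnC setDE.
have cR v : #|L v| <= #|residual U f v| + dgin U v.
  rewrite -(cardsID (f @: (nbr v :&: U)) (L v)) addnC leq_add2l.
  apply: leq_trans (subset_leq_card (subsetIr _ _)) _; exact: leq_imset_card.
have bH : bad H (residual U f).
  by split=> // v vH; have := dE v vH; have := cR v; have := dL v; clear; lia.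
split=> // v vH; apply/eqP; rewrite eqn_leq deg_le leqNgt; apply/negP => /dL_lt.
by have := bad_tight d0 bH vH; have := dE v vH; have := cR v; clear; lia.
Qed.

(** * Bad sets that remain after [U] is coloured *)

Section Blocked.
Variables (U H : {set G}) (f : G -> D).
Hypotheses (cH : closed_in H (~: U)) (bH : bad H (residual U f))
  (dH : {in H, forall v, deg v = m}) (nH : exists2 v, v \in H & 0 < dgin U v).

Lemma bad_deg v : v \in H -> dgin H v + dgin U v = m.
Proof.
move=> vH; rewrite -(dH vH) /deg -/(nbr v) -(cardsID U) addnC; congr (_ + _).
apply/eq_card => u; rewrite !inE; case: (boolP (adj v u)) => //= vu; rewrite ?andbF ?andbT //.
apply/idP/idP => [/(subsetP (proj1 (closedP _ _ cH)))|uU]; first by rewrite inE.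
by apply: (proj2 (closedP _ _ cH) v) => //; rewrite inE.
Qed.

Lemma bad_le : {in H, forall v, dgin H v <= m}.
Proof. by move=> v /bad_deg <-; rewrite leq_addr. Qed.

Lemma bad_lt : exists2 v, v \in H & dgin H v < m.
Proof. by case: nH => v vH xv; exists v; rewrite // -(bad_deg vH); move: xv; clear; lia. Qed.

Lemma bad_noncut_ext v : v \in H -> conn (H :\ v) -> 0 < dgin U v.
Proof.
move=> vH cv; have := bad_noncut d0 bH bad_le bad_lt vH cv; rewrite -(bad_deg vH).
by clear; lia.
Qed.

Lemma bad_side_ext z A : z \in H -> closed_in A (H :\ z) -> A != set0 -> m <= (ext U A).+1.
Proof.
move=> zH cA nA; have := bad_side_weight d0 bH bad_le bad_lt zH cA nA.
rewrite /ext (eq_bigr (dgin U)) // => v vA.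
by rewrite -(bad_deg (subsetP (side_sub cA) v vA)) addKn.
Qed.

(* [t |: H] would span a complete graph closed under adjacency, hence all of [G]. *)
Lemma bad_attached t : t \in U -> (forall v, v \in H -> dgin U v = adj v t) -> False.
Proof.
move=> tU xH; have [cnH _ _] := bH.
have sHU : H \subset ~: U by case/closedP: cH.
have extE A : A \subset H -> ext U A = dgin A t.
  move=> /subsetP sA; rewrite dgin_sum; apply: eq_bigr => v /sA /xH ->.
  by rewrite adj_sym.
have leA A : dgin A t <= m by apply: leq_trans (deg_le t); apply/subset_leq_card/subsetIl.
(* Both parts of a cut would hold at least [m - 1] neighbours of [t], too many for [m >= 3]. *)
have [/exists_inP[z zH ncz]|nc] := boolP [exists z in H, ~~ conn (H :\ z)].
  have [A [cA nA nC _]] := cut_side z ncz.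
  have l1 := bad_side_ext zH cA nA; have l2 := bad_side_ext zH (closedD cA) nC.
  have sA : A \subset H :\ z by case/closedP: cA.
  rewrite extE ?(side_sub cA) // in l1.
  rewrite extE ?(side_sub (closedD cA)) // in l2.
  have := leA (H :\ z); rewrite (dgin_split _ sA); move: l1 l2 m3; clear; lia.
have adjt v : v \in H -> adj v t.
  move=> vH; have := bad_noncut_ext vH; rewrite xH // lt0b; apply.
  by apply: contraNT nc => ncv; apply/exists_inP; exists v.
have tH : t \notin H by apply/negP => /(subsetP sHU); rewrite inE tU.
have sHn : H \subset nbr t by apply/subsetP => v vH; rewrite inE adj_sym adjt.
have dHv v : v \in H -> dgin H v <= #|H :\ v|.
  move=> vH; apply: subset_leq_card; apply/subsetP => u; rewrite !inE => /andP[vu ->].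
  by rewrite eq_sym adj_neq.
have [v0 v0H _] := nH.
have cHm : #|H| = m.
  apply/eqP; rewrite eqn_leq (leq_trans (subset_leq_card sHn)) ?deg_le //=.
  have := dHv v0 v0H; have := bad_deg v0H; rewrite xH // adjt // (cardsD1 v0 H) v0H.
  by clear; lia.
have eHn : H = nbr t by apply/eqP; rewrite eqEcard sHn cHm deg_le.
have adjH u v : u \in H -> v \in H -> u != v -> adj u v.
  move=> uH vH uv; have : nbr u :&: H = H :\ u.
    apply/eqP; rewrite eqEcard; apply/andP; split.
      by apply/subsetP => y; rewrite !inE => /andP[uy ->]; rewrite eq_sym adj_neq.
    have := bad_deg uH; rewrite xH // adjt // -cHm (cardsD1 u H) uH /dgin; clear; lia.
  by move/setP/(_ v); rewrite !inE vH eq_sym uv !andbT.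
have full : t |: H = [set: G].
  apply: (connP _ (connected_conn hconn)); last by apply/set0Pn; exists t; rewrite setU11.
  apply/closedP; split; first exact: subsetT.
  move=> u v; rewrite !inE => /orP[/eqP ->|uH] _ uv; first by rewrite eHn inE uv orbT.
  have [//|vt /=] := eqVneq v t; have := bad_deg uH; rewrite -(dH uH) xH // adjt // => e.
  have sub : nbr u :&: H \subset nbr u :\ t.
    apply/subsetP => y; rewrite !inE => /andP[-> yH]; rewrite andbT.
    by apply: contraNneq tH => <-.
  have : nbr u :&: H = nbr u :\ t.
    apply/eqP; rewrite eqEcard sub /=.
    move: e; rewrite /deg -/(nbr u) (cardsD1 t (nbr u)) inE adjt // /dgin; clear; lia.
  by move/setP/(_ v); rewrite !inE vt uv /= => ->.
apply: hK; apply: complete_iso; last first.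
  by rewrite -cardsT -full cardsU1 tH cHm.
move=> u v uv; have : u \in t |: H by rewrite full.
have : v \in t |: H by rewrite full.
rewrite !inE => /orP[/eqP ev|vH] /orP[/eqP eu|uH].
- by rewrite eu ev eqxx in uv.
- by rewrite ev adjt.
- by rewrite eu adj_sym adjt.
- exact: adjH.
Qed.

End Blocked.

(** A list version of the theorem of Brooks: once some [t] is coloured, an uncolourable rest would
    contain a bad set attached to [t] only, against [bad_attached]. *)
Lemma colorable_full : colorable [set: G] L.
Proof.
apply: contraT => nc; have /card_gt0P[t _] := proj1 hconn.
have [c cL] : exists c, c \in L t.
  apply/card_gt0P; have := dL t; have := @dL_lt t; move: m3; clear.
  by case: (ltnP (deg t) m) => [_ _ /(_ isT)|]; lia.
have ncr : ~~ colorable (~: [set t]) (residual [set t] (fun=> c)).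
  apply: contra nc => h; apply: (colorable_extend cL).
  have -> : [set: G] :\ t = ~: [set t] by apply/setP => v; rewrite !inE andbT.
  rewrite -(@eq_colorable _ _ _ (residual [set t] (fun=> c))) // => v _.
  apply/setP => e; rewrite /residual /del_color !inE.
  case: (boolP (adj t v)) => tv; rewrite ?inE.
    congr (~~ _ && _); apply/imsetP/eqP => [[u _ //]|->]; exists t => //.
    by rewrite !inE eqxx adj_sym tv.
  case: imsetP => // -[u]; rewrite !inE => /andP[vu /eqP ut].
  by rewrite -ut adj_sym vu in tv.
have [H cH [bH dH]] := uncolorable_bad ncr; have [cnH _ ncH] := bH.
have nH0 : H != set0.
  apply: contraNneq ncH => ->; apply/colorableP.
  by exists (fun=> d0) => [v|u v]; rewrite inE.
have xH v : v \in H -> dgin [set t] v = adj v t.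
  move=> vH; rewrite (dgin_D1 v (set11 t)) setDv [X in X + _](_ : _ = 0) //.
  by apply/eqP; rewrite cards_eq0 setI0.
have cH' : closed_in H ([set: G] :\ t).
  by have -> : [set: G] :\ t = ~: [set t] by apply/setP => v; rewrite !inE andbT.
have [v vH tv] := conn_nbr (connected_conn hconn) (in_setT t) cH' nH0.
exfalso; apply: (bad_attached cH bH dH _ (set11 t) xH).
by exists v; rewrite // xH // adj_sym tv.
Qed.

Variable r : G -> option D.
Hypothesis rL : forall v c, r v = Some c -> c \in L v.

Definition satisfied (f : G -> D) : {set G} := [set v | r v == Some (f v)].

Definition is_coloring (f : {ffun G -> D}) : bool :=
  [forall v, f v \in L v] && [forall u, forall v, adj u v ==> (f u != f v)].

Lemma is_coloringP (f : {ffun G -> D}) :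
  reflect ((forall v, f v \in L v) /\ forall u v, adj u v -> f u != f v) (is_coloring f).
Proof.
apply: (iffP andP) => [[/forallP fL /forallP fa]|[fL fa]]; split=> //.
- by move=> u v; apply: implyP; move/forallP: (fa u).
- exact/forallP.
- by apply/forallP => u; apply/forallP => v; apply/implyP/fa.
Qed.

(** * A colouring satisfying as many requests as possible *)

Section MaxColoring.
Variable phi : {ffun G -> D}.
Hypotheses (cphi : is_coloring phi)
  (maxphi : forall f, is_coloring f -> #|satisfied f| <= #|satisfied phi|).

Notation S := (satisfied phi).

Lemma request_blocked K t : conn K -> closed_in K (~: S) -> t \in K ->
  r t != None -> dgin S t = 0 -> exists H, blocked m S K t H.
Proof.
move=> cnK cK tK rt xt; have [phiL phia] := is_coloringP _ cphi.
have tS : t \notin S by have := subsetP (proj1 (closedP _ _ cK)) t tK; rewrite inE.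
case ert : (r t) rt => [c|//] _; have cL := rL ert.
pose U := t |: S; pose f v := if v == t then c else phi v.
have ntS u : u \in S -> ~~ adj t u.
  by move=> uS; apply: contra_eqN xt => tu; rewrite -lt0n dgin_gt0; apply/exists_inP; exists u.
(* A colouring of the rest would satisfy [t] besides all of [S], against maximality. *)
have nc : ~~ colorable (~: U) (residual U f).
  apply/negP => /colorableP[g gL ga].
  pose h : {ffun G -> D} := [ffun v => if v \in U then f v else g v].
  have gU v : v \notin U -> g v \in L v /\ forall u, u \in U -> adj v u -> g v != f u.
    move=> vU; have vU' : v \in ~: U by rewrite inE.
    have := gL v vU'; rewrite inE => /andP[ni gv].
    by split=> // u uU vu; apply: contraNneq ni => ->; apply: imset_f; rewrite !inE vu in uU *.
  have hc : is_coloring h.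
    apply/is_coloringP; split=> [v|u v uv]; rewrite !ffunE.
      by case: ifPn => [_|/gU[]//]; rewrite /f; case: eqVneq => [->|].
    have vu : adj v u by rewrite adj_sym.
    case: ifPn => uU; case: ifPn => vU.
    - rewrite /f; case: (eqVneq u t) uU uv => [->|ut] uU uv; case: (eqVneq v t) vU uv => [->|vt] vU uv.
      + by rewrite adj_irrefl in uv.
      + by case/setU1P: vU => [vt'|/ntS]; [rewrite vt' eqxx in vt|rewrite uv].
      + by case/setU1P: uU => [ut'|/ntS]; [rewrite ut' eqxx in ut|rewrite adj_sym uv].
      + exact: phia.
    - by rewrite eq_sym; apply: (gU v vU).2.
    - exact: (gU u uU).2.
    - by apply: ga => //; rewrite in_setC.
  have := maxphi hc; rewrite leqNgt => /negP; apply; apply: proper_card; apply/properP; split.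
    apply/subsetP => v vS; rewrite inE ffunE ifT; last by rewrite inE vS orbT.
    rewrite /f; case: (eqVneq v t) => [vt|_]; first by rewrite -vt vS in tS.
    by move: vS; rewrite inE.
  by exists t => //; rewrite inE ffunE setU11 /f eqxx ert.
have [H cH [bH dH]] := uncolorable_bad nc; have [cnH _ ncH] := bH.
have sHU : H \subset ~: U by case/closedP: cH.
have tnH : t \notin H by apply/negP => /(subsetP sHU); rewrite !inE eqxx.
(* Otherwise [phi] itself would colour [H] from the residual lists. *)
have [v vH tv] : exists2 v, v \in H & adj t v.
  apply/exists_inP; apply: contraNT ncH; rewrite negb_exists_in => /forall_inP na.
  apply/colorableP; exists phi => [v vH|u v _ _]; last exact: phia.
  rewrite inE phiL andbT; apply/imsetP => -[u]; rewrite in_setI inE => /andP[vu uU] e.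
  have ut : u != t by apply: contraTneq vu => ->; rewrite adj_sym na.
  by have := phia v u vu; rewrite e /f (negPf ut) eqxx.
have sUS : ~: U = (~: S) :\ t by apply/setP => u; rewrite !inE negb_or.
have sHS : H \subset ~: S by rewrite sUS in sHU; apply: subset_trans sHU (subsetDl _ _).
have vK : v \in K by apply: (proj2 (closedP _ _ cK) t) => //; apply: (subsetP sHS).
have sHK : H \subset K := conn_sub cK cnH sHS vK vH.
have xU u : dgin U u = dgin S u + adj u t.
  by rewrite (dgin_D1 u (setU11 t S)) /U setU1K.
have nH : exists2 v, v \in H & 0 < dgin U v.
  by exists v => //; rewrite xU adj_sym tv addn1.
exists H; split=> //.
- apply: (closed_sub cH); first by apply/subsetP => u uH; rewrite !inE (subsetP sHK) // andbT; apply: contraNneq tnH => <-.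
  by rewrite sUS; apply: setSD; case/closedP: cK.
- by exists v.
- by move=> u uH cu; rewrite -xU; apply: (bad_noncut_ext cH bH dH nH).
- move=> z A zH cA nA; apply: leq_trans (bad_side_ext cH bH dH nH zH cA nA) _.
  rewrite ltnS /ext (eq_bigr _ (fun u _ => xU u)) big_split /= leq_add2l.
  by rewrite dgin_sum; apply: leq_sum => u _; rewrite adj_sym.
- by move=> nocut; apply: (bad_regular d0 bH).
(* Without edges to [S], the set [H] would be attached to [t] alone. *)
rewrite lt0n; apply/negP => /eqP; rewrite /ext => /eqP; rewrite sum_nat_eq0 => /forall_inP e0.
apply: (bad_attached cH bH dH nH (setU11 t S)) => u uH.
by rewrite xU (eqP (e0 u uH)).
Qed.

(** At most [ext S K] vertices of [K] have a neighbour in [S]; the remaining requests are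
    blocked. *)
Lemma component_requests K : conn K -> closed_in K (~: S) ->
  #|[set v in K | r v != None]| <= 5 * ext S K.
Proof.
move=> cnK cK; set R := [set v in K | r v != None].
pose T := [set v in R | dgin S v == 0].
have TP t : t \in T -> [/\ t \in K, r t != None & dgin S t = 0].
  by rewrite !inE => /andP[/andP[-> ->] /eqP].
have [Hs bHs] : exists Hs : G -> {set G}, forall t, t \in T -> blocked m S K t (Hs t).
  apply: (@fin_all_exists _ (fun=> {set G}) (fun t H => t \in T -> blocked m S K t H)) => t.
  have [/TP[tK rt xt]|_] := boolP (t \in T); last by exists set0.
  by have [H bH] := request_blocked cnK cK tK rt xt; exists H.
have KS : [disjoint K & S].
  by rewrite disjoints_subset; case/closedP: cK.
have nK v : v \in K -> nbr v \subset K :|: S.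
  move=> vK; apply/subsetP => u; rewrite inE => vu; rewrite inE.
  have [//|uS] := boolP (u \in S); rewrite ?orbT // orbF.
  by apply: (proj2 (closedP _ _ cK) v) => //; rewrite inE.
have sTK : T \subset K by apply/subsetP => t /TP[].
have xT t : t \in T -> dgin S t = 0 by case/TP.
have cT := blocked_requests_card m3 cnK KS nK sTK xT bHs.
have : #|[set v in K | 0 < dgin S v]| <= ext S K.
  apply: leq_trans (ext_sub S (_ : [set v in K | 0 < dgin S v] \subset K)).
    by apply: sum_pos_card => v; rewrite inE => /andP[].
  by apply/subsetP => v; rewrite inE => /andP[].
have : #|R| <= #|T :|: [set v in K | 0 < dgin S v]|.
  apply: subset_leq_card; apply/subsetP => v; rewrite !inE => /andP[vK rv].
  by rewrite vK rv /=; case: (dgin S v).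
move: (leq_card_setU T [set v in K | 0 < dgin S v]).1 cT; clear; lia.
Qed.

Lemma closed_requests A : closed_in A (~: S) ->
  #|[set v in A | r v != None]| <= 5 * ext S A.
Proof.
have [n] := ubnP #|A|; elim: n => // n IH in A * => ltn cA.
have [A0|nA] := eqVneq A set0.
  by rewrite A0 (_ : [set v in set0 | _] = set0) ?cards0 //; apply/setP => v; rewrite !inE.
have [K [sKA cK cnK nK]] := closed_conn cA nA.
have ltK : #|A :\: K| < n.
  rewrite -ltnS; apply: leq_trans ltn; rewrite ltnS; apply: proper_card; apply/properP; split; first exact: subsetDl.
  by case/set0Pn: nK => v vK; exists v; rewrite ?(subsetP sKA) // inE vK.
have cAK : closed_in (A :\: K) (~: S).
  apply/closedP; have /closedP[sA cA'] := cA; split; first by apply: subset_trans (subsetDl _ _) sA.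
  move=> u v; rewrite !inE => /andP[uK uA] vS uv.
  rewrite (cA' u) ?inE // andbT; apply: contra uK => vK.
  apply: (proj2 (closedP _ _ cK) v) => //; last by rewrite adj_sym.
  exact: (subsetP sA).
have cntK := component_requests cnK cK; have cntA := IH _ ltK cAK.
rewrite (ext_split S sKA); have : #|[set v in A | r v != None]| <=
    #|[set v in K | r v != None] :|: [set v in A :\: K | r v != None]|.
  apply: subset_leq_card; apply/subsetP => v; rewrite !inE => /andP[-> ->].
  by case: (v \in K).
move: (leq_card_setU [set v in K | r v != None] [set v in A :\: K | r v != None]).1.
by move: cntK cntA; clear; lia.
Qed.

Lemma max_coloring_satisfies : #|[set v | r v != None]| <= 6 * m * #|S|.
Proof.
have cS : closed_in (~: S) (~: S) by apply/closedP.
have le := closed_requests cS.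
(* The edges are counted from their ends in [S]. *)
have eS : ext S (~: S) <= m * #|S|.
  rewrite /ext (eq_bigr _ (fun v _ => dgin_sum S v)) exchange_big /= mulnC -sum_nat_const.
  apply: leq_sum => u _; rewrite (eq_bigr (fun v => nat_of_bool (adj u v))); last by move=> v _; rewrite adj_sym.
  by rewrite -dgin_sum; apply: leq_trans (deg_le u); apply/subset_leq_card/subsetIl.
have : #|[set v | r v != None]| <= #|S :|: [set v in ~: S | r v != None]|.
  by apply: subset_leq_card; apply/subsetP => v; rewrite !inE => ->; rewrite andbT orbN.
have : #|S| <= m * #|S| by rewrite leq_pmull // (leq_trans _ m3).
move: (leq_card_setU S [set v in ~: S | r v != None]).1 le eS.
by rewrite -mulnA; move: (m * #|S|); clear; lia.
Qed.

End MaxColoring.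

Theorem finite_lists_flexible : exists f : G -> D,
  [/\ forall v, f v \in L v, forall u v, adj u v -> f u != f v &
      #|[set v | r v != None]| <= 6 * m * #|satisfied f|].
Proof.
have /colorableP[f fL fa] := colorable_full.
have cf : is_coloring (finfun f).
  by apply/is_coloringP; split=> [v|u v uv]; rewrite !ffunE; [apply: fL|apply: fa].
case: (@arg_maxnP _ (finfun f) is_coloring (fun f => #|satisfied f|) cf) => phi cphi maxphi.
have [pL pa] := is_coloringP _ cphi.
by exists phi; split=> //; apply: max_coloring_satisfies.
Qed.

End FiniteLists.

(** * Reduction to finite lists *)

From mathcomp Require Import all_order all_algebra.
From mathcomp Require Import boolp classical_sets functions cardinality.

Import Order.TTheory GRing.Theory Num.Theory.

Lemma card_geq_seq (C : eqType) (A : set C) n : card_geq A n ->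
  exists s : seq C, [/\ uniq s, size s = n & forall c, c \in s -> A c].
Proof.
move=> /card_leP[f]; pose g (i : 'I_n) : C := val (f (SigSub (mem_set (ltn_ord i : `I_n i)))).
exists [seq g i | i <- enum 'I_n]; split.
- rewrite map_inj_uniq ?enum_uniq // => i j /val_inj /(@inj _ _ _ f).
  by rewrite !in_setT => /(_ isT isT) /(congr1 val) /= /val_inj.
- by rewrite size_map size_enum_ord.
- by move=> c /mapP[i _ ->]; exact: set_valP.
Qed.

(** Lists may be infinite, so finite sublists are chosen; adding the requested colour keeps the
    request legitimate. *)
Lemma finite_sublists (G : sgraph) (C : eqType) (L : list_assignment G C) (r : G -> option C) :
    degree_lists L -> request L r ->
  exists F : G -> seq C, forall v,
    [/\ uniq (F v), forall c, c \in F v -> L v c, forall c, r v = Some c -> c \in F v,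
        deg v <= size (F v) & deg v < max_degree G -> deg v < size (F v)].
Proof.
move=> LL rL; suff h v : exists s : seq C,
    [/\ uniq s, forall c, c \in s -> L v c, forall c, r v = Some c -> c \in s,
        deg v <= size s & deg v < max_degree G -> deg v < size s].
  by have [F hF] := fin_all_exists h; exists F.
have [s [us sL [s1 s2]]] : exists s : seq C, [/\ uniq s, forall c, c \in s -> L v c &
    deg v <= size s /\ (deg v < max_degree G -> deg v < size s)].
  have [lt eq] := LL v; have le : deg v <= max_degree G by apply: leq_bigmax.
  have [/lt/card_geq_seq[s [us ss sL]]|ge] := ltnP (deg v) (max_degree G).
    by exists s; rewrite ss leqnSn.
  have {}eq : card_geq (L v) (deg v) by apply: eq; apply/eqP; rewrite eqn_leq le.
  have [s [us ss sL]] := card_geq_seq eq.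
  by exists s; rewrite ss leqnn; split=> //; split=> // /(leq_trans _)/(_ ge); rewrite ltnn.
pose s' := undup (if r v is Some c then c :: s else s).
have le : size s <= size s'.
  by apply: uniq_leq_size => // c cs; rewrite mem_undup; case: (r v) => [b|] //; rewrite inE cs orbT.
exists s'; split; first exact: undup_uniq.
- move=> c; rewrite mem_undup; case e : (r v) => [b|]; last exact: sL.
  by rewrite inE => /orP[/eqP ->|/sL//]; apply: rL.
- by move=> c e; rewrite mem_undup e mem_head.
- exact: leq_trans le.
- by move=> /s2 h; apply: leq_trans le.
Qed.

Local Open Scope ring_scope.

Theorem theorem2p8 (R : realFieldType) (G : sgraph) (C : eqType)
    (hconn : connected_graph G) (hdeg : (3 <= max_degree G)%N)
    (hK : ~ graph_iso G (complete_graph (max_degree G).+1)) :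
  flexibly_choosable (1 / (6 * (max_degree G)%:R) : R) (@degree_lists G C).
Proof.
move=> L LL r rL; have [F hF] := finite_sublists LL rL.
have /card_gt0P[v0 _] := proj1 hconn.
(* The default colour for [nth]. Even a vertex of degree 0 has a colour, as its degree is below the
   maximum. *)
have [c0 _] : exists c, c \in F v0.
  have [_ _ _ le lt] := hF v0; case: (F v0) le lt => [|c s] /=; last by exists c; rewrite mem_head.
  by rewrite leqn0 => /eqP -> /(_ (leq_trans _ hdeg)) h; have := h isT.
pose cs := undup (c0 :: flatten [seq F v | v <- enum G]).
have Fcs v c : c \in F v -> c \in cs.
  move=> cF; rewrite mem_undup inE; apply/orP; right; apply/flattenP; exists (F v) => //.
  by apply: map_f; rewrite mem_enum.
have cs0 : (0 < size cs)%N.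
  by rewrite -has_predT; apply/hasP; exists c0; rewrite // mem_undup mem_head.
have ucs : uniq cs by apply: undup_uniq.
pose col (i : 'I_(size cs)) := nth c0 cs i.
have col_inj : injective col.
  by move=> i j /eqP; rewrite nth_uniq // => /eqP /val_inj.
have colE c : c \in cs -> exists i, col i = c.
  by rewrite -index_mem => lt; exists (Ordinal lt); rewrite /col /= nth_index // -index_mem.
pose L' (v : G) : {set 'I_(size cs)} := [set i | col i \in F v]%SET.
(* Colours become indices into the palette [cs]. It contains all requested colours, so [insub] never
   drops a request. *)
pose r' (v : G) : option 'I_(size cs) := if r v is Some c then insub (index c cs) else None.
have r'E v i : (r' v == Some i) = (r v == Some (col i)).
  rewrite /r'; case: (r v) => [c|] //; case: insubP => [j _ jE|].
    have [ccs|ncs] := boolP (c \in cs).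
      have -> : c = col j by rewrite /col jE nth_index.
      by apply/eqP/eqP => [[->]|[/col_inj ->]].
    by have := ltn_ord j; rewrite jE index_mem (negPf ncs).
  rewrite index_mem => ncs; symmetry; apply/negbTE; apply: contra ncs => /eqP[->].
  by rewrite mem_nth.
have sL v : (size (F v) <= #|L' v|)%N.
  have [uF _ _ _ _] := hF v; rewrite -(size_image col); apply: uniq_leq_size => // c cF.
  have [i ic] := colE c (Fcs v c cF); rewrite -ic.
  by apply: map_f; rewrite mem_enum inE ic.
have [|||f [fL fa fr]] := @finite_lists_flexible G _ (Ordinal cs0) L' hconn hdeg hK _ _ r'.
- by move=> v; have [_ _ _ le _] := hF v; apply: leq_trans (sL v).
- by move=> v; have [_ _ _ _ lt] := hF v; move/lt => h; apply: leq_trans (sL v).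
- move=> v i /eqP; rewrite r'E => /eqP rv; rewrite inE.
  by have [_ _ rF _ _] := hF v; apply: rF.
exists (fun v => col (f v)).
  split=> [x y xy /col_inj|v]; first by apply/eqP/fa.
  by have [_ FL _ _ _] := hF v; apply: FL; have := fL v; rewrite inE.
have domE : dom r = [set v | r' v != None]%SET.
  apply/setP => v; rewrite !inE; apply: congr1; case e : (r v) => [c|]; last by rewrite /r' e.
  have [_ _ rF _ _] := hF v; have [i ic] := colE c (Fcs _ _ (rF c e)).
  by have := r'E v i; rewrite e ic eqxx => /eqP ->.
have satE : satisfied r' f \subset [set v in dom r | r v == Some (col (f v))]%SET.
  by apply/fintype.subsetP => v; rewrite !inE r'E => /eqP ->; rewrite eqxx.
have le : (#|dom r| <= 6 * max_degree G * #|[set v in dom r | r v == Some (col (f v))]%SET|)%N.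
  rewrite {1}domE; apply: leq_trans fr _; rewrite leq_mul2l; apply/orP; right.
  exact: subset_leq_card.
have m0 : 0 < 6 * (max_degree G)%:R :> R.
  by rewrite mulr_gt0 ?ltr0n // (leq_trans _ hdeg).
by rewrite div1r mulrC ler_pdivrMr // -!natrM ler_nat mulnC.
Qed.
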